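(* Let $\beta$ be a positive integer and let $z\in\mathbb{C}$ with $\operatorname{Re}(z)\leq 0$. Then \begin{align} \sum_{n \leq x}\sigma_{z,\beta}(n) - \frac{1}{2}\sigma_{z,\beta}(x)\,\mathbf{1}_{x\in\mathbb{Z}} = D_{z,\beta}(x)+\Delta_{z,\beta}(x), \nonumber \end{align} where \begin{align} \Delta_{z,\beta}(x)\ll x^{\frac{1}{3}}\log^2 x \nonumber \end{align} uniformly for $\beta\geq 1$, and $D_{z,\beta}(x)$ is given as follows. (i) If $\beta=1,2$ and $-\tfrac{2}{3\beta^2}<\operatorname{Re}(z)\leq 0$, then \begin{align} D_{z,\beta}(x)=\zeta (\beta (1 - z))x + \frac{1}{1 + \beta z}\zeta \left( z + \frac{1}{\beta } \right)x^{z + \tfrac{1}{\beta }} . \nonumber \end{align} (ii) If $\beta\geq 3$ and $-1<\operatorname{Re}(z)\leq 0$, then \begin{align} D_{z,\beta}(x)=\zeta (\beta (1 - z))x . \nonumber \end{align}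
   Context: For a positive integer $\beta$ and $z\in\mathbb{C}$, the generalized divisor function is $\sigma_{z,\beta}(n) := \sum_{d^\beta \mid n} d^{\beta z}$. The left-hand side is the sum over $n\le x$ in which, when $x$ is a positive integer, the last term $n=x$ is counted with weight $1/2$ (i.e. $\sum_{n\le x}f(n)-\tfrac12 f(x)$ for integer $x$, and the ordinary sum otherwise). $\zeta$ is the Riemann zeta-function. The case $\beta=1$, $z=0$ (classical Dirichlet divisor problem) is excluded in the proof. *)

(* Defs.v *)
From Stdlib Require Import Reals Arith ZArith Lra Lia.
From Coquelicot Require Import Coquelicot.
Open Scope R_scope.

Definition Cexp (w : C) : C :=
  (exp (Re w) * cos (Im w), exp (Re w) * sin (Im w)).

(* [x ^ s] for real [x > 0], with the real logarithm; a junk value for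
   [x <= 0]. *)
Definition cpow (x : R) (s : C) : C := Cexp (s * RtoC (ln x)).

Definition zeta_partial (s : C) (N : nat) : C :=
  (sum_n_m (fun n => cpow (INR n) (- s)) 1 N
   - cpow (INR N) (1 - s) / (1 - s))%C.

(* The Riemann zeta function on the half-plane [0 < Re s], [s <> 1]; outside
   it the value is not meaningful.  There
     zeta s = lim_{N -> oo} (sum_{n <= N} n^(-s) - N^(1-s) / (1-s)).
   [zeta_Dirichlet_series] and [zeta_holomorphic] below show that this is the
   analytic continuation of the Dirichlet series to that (connected) domain. *)
Definition zeta (s : C) : C :=
  iota (fun l : C_CompleteNormedModule =>
          filterlim (zeta_partial s) eventually (locally l)).

Lemma C_eq (u v : C) : Re u = Re v -> Im u = Im v -> u = v.
Proof. destruct u, v; simpl; intros -> ->; reflexivity. Qed.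

Lemma Cexp_plus (u v : C) : Cexp (u + v) = (Cexp u * Cexp v)%C.
Proof.
apply C_eq; destruct u as [a b], v as [c d]; unfold Cexp; simpl;
  rewrite exp_plus, ?cos_plus, ?sin_plus; ring.
Qed.

Lemma Cmod_Cexp (w : C) : Cmod (Cexp w) = exp (Re w).
Proof.
destruct w as [a b]; unfold Cexp, Cmod; simpl.
replace (_ + _) with (Rsqr (exp a)).
- apply sqrt_Rsqr, Rlt_le, exp_pos.
- pose proof (sin2_cos2 b) as H; unfold Rsqr in *.
  transitivity (exp a * exp a * (sin b * sin b + cos b * cos b)); [|ring].
  rewrite H; ring.
Qed.

Lemma cpow_plus (x : R) (u v : C) : cpow x (u + v) = (cpow x u * cpow x v)%C.
Proof. unfold cpow; rewrite Cmult_plus_distr_r; apply Cexp_plus. Qed.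

Lemma cpow_real (x r : R) : 0 < x -> cpow x (RtoC r) = RtoC (Rpower x r).
Proof.
intros; unfold cpow, Rpower; rewrite <- RtoC_mult.
apply C_eq; simpl; rewrite ?cos_0, ?sin_0; ring.
Qed.

Lemma Cmod_cpow (x : R) (s : C) : 0 < x -> Cmod (cpow x s) = Rpower x (Re s).
Proof.
intros; unfold cpow; rewrite Cmod_Cexp; unfold Rpower.
f_equal; destruct s; simpl; ring.
Qed.

Definition Cder (f : R -> C) (t : R) (l : C) : Prop :=
  is_derive (fun u => Re (f u)) t (Re l) /\ is_derive (fun u => Im (f u)) t (Im l).

Lemma Cder_eq f t l l' : Cder f t l -> l = l' -> Cder f t l'.
Proof. intros ? <-; assumption. Qed.

Lemma Cder_const (c : C) t : Cder (fun _ => c) t (RtoC 0).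
Proof. split; simpl; apply (is_derive_const (K := R_AbsRing) (V := R_NormedModule)). Qed.

Lemma Cder_RtoC f t l : is_derive f t l -> Cder (fun u => RtoC (f u)) t (RtoC l).
Proof.
intros H; split; simpl; [exact H|].
apply (is_derive_const (K := R_AbsRing) (V := R_NormedModule)).
Qed.

Lemma Cder_plus f g t l m :
  Cder f t l -> Cder g t m -> Cder (fun u => (f u + g u)%C) t (l + m)%C.
Proof.
intros [H1 H2] [H3 H4]; split; simpl.
- exact (is_derive_plus _ _ _ _ _ H1 H3).
- exact (is_derive_plus _ _ _ _ _ H2 H4).
Qed.

Lemma Cder_mult f g t l m :
  Cder f t l -> Cder g t m ->
  Cder (fun u => (f u * g u)%C) t (l * g t + f t * m)%C.
Proof.
intros [H1 H2] [H3 H4]; split; simpl.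
- pose proof (is_derive_mult _ _ _ _ _ H1 H3 Rmult_comm) as A.
  pose proof (is_derive_mult _ _ _ _ _ H2 H4 Rmult_comm) as B.
  pose proof (is_derive_minus _ _ _ _ _ A B) as D.
  unfold plus, minus, mult, opp, plus in D; simpl in D; unfold Re, Im in *.
  match type of D with is_derive _ _ ?e =>
    match goal with |- is_derive _ _ ?e' => replace e' with e by ring; exact D end
  end.
- pose proof (is_derive_mult _ _ _ _ _ H1 H4 Rmult_comm) as A.
  pose proof (is_derive_mult _ _ _ _ _ H2 H3 Rmult_comm) as B.
  pose proof (is_derive_plus _ _ _ _ _ A B) as D.
  unfold plus, mult in D; simpl in D; unfold Re, Im in *.
  match type of D with is_derive _ _ ?e =>
    match goal with |- is_derive _ _ ?e' => replace e' with e by ring; exact D end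
  end.
Qed.

Lemma Cder_scal (c : C) f t l :
  Cder f t l -> Cder (fun u => (c * f u)%C) t (c * l)%C.
Proof.
intros H; apply (Cder_eq _ _ _ _ (Cder_mult _ _ _ _ _ (Cder_const c t) H)); ring.
Qed.

Lemma Cder_Cexp (w : C) f t l :
  is_derive f t l ->
  Cder (fun u => Cexp (w * RtoC (f u))) t (RtoC l * (w * Cexp (w * RtoC (f t))))%C.
Proof.
intros H; destruct w as [a b].
assert (E : forall r, ((a, b) * RtoC r)%C = (a * r, b * r))
  by (intros; apply C_eq; simpl; ring).
assert (D : Derive (fun x => f x) t = l) by (apply is_derive_unique; exact H).
rewrite E; split.
- apply (is_derive_ext (fun u => exp (a * f u) * cos (b * f u))).
  { intros u; rewrite E; reflexivity. }
  auto_derive.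
  + repeat split; exists l; exact H.
  + rewrite D; simpl; ring.
- apply (is_derive_ext (fun u => exp (a * f u) * sin (b * f u))).
  { intros u; rewrite E; reflexivity. }
  auto_derive.
  + repeat split; exists l; exact H.
  + rewrite D; simpl; ring.
Qed.

Lemma is_derive_ln t : 0 < t -> is_derive ln t (/ t).
Proof. intros; apply is_derive_Reals, derivable_pt_lim_ln; assumption. Qed.

Lemma Cder_cpow (s : C) t :
  0 < t -> Cder (fun u => cpow u s) t (RtoC (/ t) * (s * cpow t s))%C.
Proof. intros; apply Cder_Cexp, is_derive_ln; assumption. Qed.

Lemma mvt2 (p g g' : R -> R) (a c M : R) :
  (forall t, a <= t <= a + 1 -> is_derive p t (g t)) ->
  (forall t, a <= t <= a + 1 -> is_derive g t (g' t)) ->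
  (forall t, a <= t <= a + 1 -> Rabs (g' t) <= M) ->
  a <= c <= a + 1 ->
  Rabs (p (a + 1) - p a - g c) <= M.
Proof.
intros Hp Hg HM Hc.
assert (HC : forall f f' : R -> R, forall t, is_derive f t (f' t) -> continuity_pt f t).
{ intros f f' t H; apply continuity_pt_filterlim.
  apply (ex_derive_continuous (K := R_AbsRing) (V := R_NormedModule)); eexists; exact H. }
destruct (MVT_gen p a (a + 1) g) as [x [Hx Ex]].
{ intros t; rewrite Rmin_left, Rmax_right by lra; intros; apply Hp; lra. }
{ intros t; rewrite Rmin_left, Rmax_right by lra; intros; apply (HC p g), Hp; lra. }
rewrite Rmin_left, Rmax_right in Hx by lra.
destruct (MVT_gen g c x g') as [y [Hy Ey]].
{ intros t H; apply Hg; revert H; unfold Rmin, Rmax; destruct (Rle_dec c x); lra. }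
{ intros t H; apply (HC g g'), Hg; revert H; unfold Rmin, Rmax; destruct (Rle_dec c x); lra. }
assert (Hy' : a <= y <= a + 1) by
  (revert Hy; unfold Rmin, Rmax; destruct (Rle_dec c x); lra).
replace (p (a + 1) - p a - g c) with (g' y * (x - c)) by lra.
rewrite Rabs_mult; specialize (HM y Hy').
assert (Rabs (x - c) <= 1) by (apply Rabs_le; lra).
pose proof (Rabs_pos (g' y)); pose proof (Rabs_pos (x - c)); nra.
Qed.

Lemma Cmod_le_2 (u : C) (M : R) : Rabs (Re u) <= M -> Rabs (Im u) <= M -> Cmod u <= 2 * M.
Proof.
intros H1 H2.
replace u with (RtoC (Re u) + Ci * RtoC (Im u))%C
  by (apply C_eq; simpl; ring).
eapply Rle_trans; [apply Cmod_triangle|].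
rewrite Cmod_mult, Cmod_Ci, !Cmod_R; lra.
Qed.

Lemma im_le_Cmod (u : C) : Rabs (Im u) <= Cmod u.
Proof. eapply Rle_trans; [apply Rmax_r | apply Rmax_Cmod]. Qed.

Lemma Cmvt2 (P G G' : R -> C) (a c M : R) :
  (forall t, a <= t <= a + 1 -> Cder P t (G t)) ->
  (forall t, a <= t <= a + 1 -> Cder G t (G' t)) ->
  (forall t, a <= t <= a + 1 -> Cmod (G' t) <= M) ->
  a <= c <= a + 1 ->
  Cmod (P (a + 1)%R - P a - G c)%C <= 2 * M.
Proof.
intros HP HG HM Hc.
apply Cmod_le_2.
- apply (mvt2 (fun t => Re (P t)) (fun t => Re (G t)) (fun t => Re (G' t))); trivial.
  + intros; apply HP; trivial.
  + intros; apply HG; trivial.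
  + intros; eapply Rle_trans; [apply re_le_Cmod | auto].
- apply (mvt2 (fun t => Im (P t)) (fun t => Im (G t)) (fun t => Im (G' t))); trivial.
  + intros; apply HP; trivial.
  + intros; apply HG; trivial.
  + intros; eapply Rle_trans; [apply im_le_Cmod | auto].
Qed.

Lemma Cexp_taylor2 (w : C) :
  Cmod (Cexp w - 1 - w)%C <= 2 * (Cmod w * Cmod w * exp (Cmod w)).
Proof.
pose proof (Cmvt2 (fun u => Cexp (w * RtoC u)) (fun u => w * Cexp (w * RtoC u))%C
  (fun u => w * (w * Cexp (w * RtoC u)))%C 0 0
  (Cmod w * Cmod w * exp (Cmod w))) as H.
assert (D : forall t, Cder (fun u => Cexp (w * RtoC u)) t (w * Cexp (w * RtoC t))%C).
{ intros t; eapply Cder_eq.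
  - apply (Cder_Cexp w (fun u => u) t 1), (is_derive_id (K := R_AbsRing)).
  - simpl; ring. }
cbv beta in H.
replace (Cexp (w * RtoC (0 + 1))) with (Cexp w) in H
  by (f_equal; rewrite Rplus_0_l; ring).
replace (Cexp (w * RtoC 0)) with (RtoC 1) in H.
2:{ replace (w * RtoC 0)%C with (RtoC 0) by ring.
    apply C_eq; simpl; rewrite exp_0, ?cos_0, ?sin_0; ring. }
replace (w * 1)%C with w in H by ring.
apply H; try lra.
- intros; apply D.
- intros; apply Cder_scal, D.
- intros t Ht; rewrite !Cmod_mult, Cmod_Cexp, <- Rmult_assoc.
  apply Rmult_le_compat_l; [apply Rmult_le_pos; apply Cmod_ge_0|].
  assert (E : Re (w * RtoC t) <= Cmod w).
  { replace (Re (w * RtoC t)) with (Re w * t) by (destruct w; simpl; ring).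
    pose proof (re_le_Cmod w); pose proof (Rle_abs (Re w)).
    pose proof (Cmod_ge_0 w); nra. }
  destruct E as [E | ->]; [left; apply exp_increasing, E | right; reflexivity].
Qed.

Lemma ln_le_Rpower t d : 1 <= t -> 0 < d -> 0 <= ln t <= / d * Rpower t d.
Proof.
intros Ht Hd; split; [rewrite <- ln_1; apply ln_le; lra|].
apply Rmult_le_reg_l with d; [lra|].
rewrite <- Rmult_assoc, Rinv_r, Rmult_1_l by lra.
unfold Rpower.
destruct (Req_dec (d * ln t) 0) as [->|N]; [rewrite exp_0; lra|].
pose proof (exp_ineq1 (d * ln t) N); lra.
Qed.

Definition zincr (P G : R -> C) (n : nat) : C :=
  (P (INR n + 1 + 1)%R - P (INR n + 1)%R - G (INR n + 1 + 1)%R)%C.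

Lemma zincr_bound (P G G' : R -> C) (M e : R) (n : nat) :
  0 <= M -> 0 < e ->
  (forall t, 1 <= t -> Cder P t (G t)) ->
  (forall t, 1 <= t -> Cder G t (G' t)) ->
  (forall t, 1 <= t -> Cmod (G' t) <= M * Rpower t (- (1 + e))) ->
  Cmod (zincr P G n) <= 2 * M * Rpower (INR n + 1) (- (1 + e)).
Proof.
intros HM He HP HG HG'.
pose proof (pos_INR n).
unfold zincr; rewrite Rmult_assoc; apply (Cmvt2 P G G'); try lra.
- intros; apply HP; lra.
- intros; apply HG; lra.
- intros t Ht; eapply Rle_trans; [apply HG'; lra|].
  apply Rmult_le_compat_l; [exact HM|].
  rewrite !Rpower_Ropp; apply Rinv_le_contravar; [apply exp_pos|].
  apply Rle_Rpower_l; lra.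
Qed.

Lemma ex_series_Rpower (e : R) :
  0 < e -> ex_series (fun n => Rpower (INR n + 1) (- (1 + e))).
Proof.
intros He; apply ex_series_incr_1.
apply (ex_series_le (K := R_AbsRing) (V := R_CompleteNormedModule) _
  (fun n => / e * (Rpower (INR n + 1) (- e) - Rpower (INR (S n) + 1) (- e)))).
- intros n; pose proof (pos_INR n) as Hn.
  unfold norm; simpl norm; rewrite S_INR.
  unfold abs; simpl; rewrite Rabs_pos_eq by (left; apply exp_pos).
  destruct (MVT_gen (fun t => Rpower t (- e)) (INR n + 1) (INR n + 1 + 1)
    (fun t => - e * Rpower t (- (1 + e)))) as [x [Hx Ex]].
  + intros t; rewrite Rmin_left, Rmax_right by lra; intros Ht.
    apply is_derive_Reals.
    replace (- (1 + e)) with (- e - 1) by ring.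
    apply derivable_pt_lim_power; lra.
  + intros t; rewrite Rmin_left, Rmax_right by lra; intros Ht.
    apply derivable_continuous_pt; eexists; apply derivable_pt_lim_power; lra.
  + rewrite Rmin_left, Rmax_right in Hx by lra.
    replace (Rpower (INR n + 1) (- e) - Rpower (INR n + 1 + 1) (- e))
      with (e * Rpower x (- (1 + e))) by lra.
    rewrite <- Rmult_assoc, Rinv_l, Rmult_1_l by lra.
    rewrite !Rpower_Ropp; apply Rinv_le_contravar; [apply exp_pos|].
    apply Rle_Rpower_l; lra.
- apply (ex_series_scal_l (K := R_AbsRing) (V := R_NormedModule)).
  set (u := fun n => Rpower (INR n + 1) (- e)).
  destruct (ex_finite_lim_seq_decr u 0) as [l Hl].
  + intros n; unfold u; rewrite S_INR; pose proof (pos_INR n).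
    rewrite !Rpower_Ropp; apply Rinv_le_contravar; [apply exp_pos|].
    apply Rle_Rpower_l; lra.
  + intros n; left; apply exp_pos.
  + exists (u 0%nat - l).
    change (is_lim_seq (sum_n (fun n => u n - u (S n))) (u 0%nat - l)).
    apply (is_lim_seq_ext (fun n => u 0%nat - u (S n))).
    * intros n; rewrite sum_n_Reals; induction n as [|n IH]; simpl; [reflexivity|].
      rewrite <- IH; unfold u; lra.
    * apply is_lim_seq_minus'; [apply is_lim_seq_const|].
      apply -> is_lim_seq_incr_1; exact Hl.
Qed.

Lemma cpow_1_minus (t : R) (s : C) : 0 < t -> cpow t (1 - s) = (RtoC t * cpow t (- s))%C.
Proof.
intros; unfold Cminus; rewrite cpow_plus, cpow_real, Rpower_1; trivial.
Qed.

Lemma RtoC_neq_0 (t : R) : t <> 0 -> RtoC t <> RtoC 0.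
Proof. intros H E; apply H, RtoC_inj, E. Qed.

Definition zP (s : C) (t : R) : C := (/ (1 - s) * cpow t (1 - s))%C.
Definition zG (s : C) (t : R) : C := cpow t (- s).
Definition zG' (s : C) (t : R) : C := (RtoC (/ t) * (- s * cpow t (- s)))%C.
Definition zQ (s : C) (t : R) : C :=
  (cpow t (1 - s) * (/ (1 - s) * / (1 - s) + - / (1 - s) * RtoC (ln t)))%C.
Definition zH (s : C) (t : R) : C := (-1 * (RtoC (ln t) * cpow t (- s)))%C.
Definition zH' (s : C) (t : R) : C :=
  (-1 * (RtoC (/ t) * cpow t (- s) + RtoC (ln t) * (RtoC (/ t) * (- s * cpow t (- s)))))%C.

Lemma zP_der s t : s <> RtoC 1 -> 0 < t -> Cder (zP s) t (zG s t).
Proof.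
intros Hs Ht.
assert (H1 : (1 - s)%C <> RtoC 0).
{ intros E; apply Hs; replace s with (1 - (1 - s))%C by ring; rewrite E; ring. }
eapply Cder_eq; [apply Cder_scal, Cder_cpow, Ht|].
unfold zG; rewrite cpow_1_minus, RtoC_inv by lra.
field; repeat split; trivial; apply RtoC_neq_0; lra.
Qed.

Lemma zG_der s t : 0 < t -> Cder (zG s) t (zG' s t).
Proof. exact (Cder_cpow (- s) t). Qed.

Lemma zQ_der s t : s <> RtoC 1 -> 0 < t -> Cder (zQ s) t (zH s t).
Proof.
intros Hs Ht.
assert (H1 : (1 - s)%C <> RtoC 0).
{ intros E; apply Hs; replace s with (1 - (1 - s))%C by ring; rewrite E; ring. }
eapply Cder_eq.
- apply Cder_mult; [apply Cder_cpow, Ht|].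
  apply Cder_plus; [apply Cder_const|].
  apply Cder_scal, (Cder_RtoC ln t (/ t)), is_derive_ln, Ht.
- unfold zH; rewrite cpow_1_minus, RtoC_inv by lra.
  field; repeat split; trivial; apply RtoC_neq_0; lra.
Qed.

Lemma zH_der s t : 0 < t -> Cder (zH s) t (zH' s t).
Proof.
intros Ht.
refine (Cder_scal (-1) _ _ _ (Cder_mult (fun u => RtoC (ln u)) (zG s) _ _ _ _ _)).
- apply (Cder_RtoC ln t (/ t)), is_derive_ln, Ht.
- exact (Cder_cpow (- s) t Ht).
Qed.

Lemma Rinv_Rpower t r : 0 < t -> / t * Rpower t r = Rpower t (-1 + r).
Proof.
intros; rewrite Rpower_plus; replace (-1) with (- (1)) by ring.
rewrite Rpower_Ropp, Rpower_1; trivial.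
Qed.

Lemma Rpower_le_exp t a b : 1 <= t -> a <= b -> Rpower t a <= Rpower t b.
Proof. intros; apply Rle_Rpower; lra. Qed.

Lemma zG'_bound s t :
  1 <= t -> Cmod (zG' s t) <= Cmod s * Rpower t (- (1 + Re s)).
Proof.
intros Ht; unfold zG'.
rewrite !Cmod_mult, Cmod_R, Cmod_opp, Cmod_cpow by lra.
rewrite Rabs_pos_eq by (left; apply Rinv_0_lt_compat; lra).
rewrite (Rmult_comm (/ t)), Rmult_assoc, (Rmult_comm _ (/ t)), Rinv_Rpower by lra.
right; do 2 f_equal; destruct s; simpl; ring.
Qed.

Lemma zH'_bound s t e :
  1 <= t -> 0 < e ->
  Cmod (zH' s t) <= (1 + Cmod s * / e) * Rpower t (- (1 + (Re s - e))).
Proof.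
intros Ht He; unfold zH'.
rewrite Cmod_mult.
replace (Cmod (-1)) with 1 by (rewrite Cmod_R, Rabs_left; lra).
rewrite Rmult_1_l.
eapply Rle_trans; [apply Cmod_triangle|].
destruct (ln_le_Rpower t e Ht He) as [L0 L1].
rewrite !Cmod_mult, !Cmod_R, Cmod_opp, Cmod_cpow by lra.
rewrite !Rabs_pos_eq by (trivial; left; apply Rinv_0_lt_compat; lra).
replace (Re (- s)) with (- Re s) by (destruct s; reflexivity).
assert (B : / t * Rpower t (- Re s) <= Rpower t (- (1 + (Re s - e)))).
{ rewrite Rinv_Rpower by lra; apply Rpower_le_exp; lra. }
assert (B2 : ln t * (/ t * Rpower t (- Re s)) <= / e * Rpower t (- (1 + (Re s - e)))).
{ replace (- (1 + (Re s - e))) with (e + (-1 + - Re s)) by ring.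
  rewrite Rpower_plus, Rinv_Rpower, <- (Rmult_assoc (/ e)) by lra.
  apply Rmult_le_compat_r; [left; apply exp_pos | exact L1]. }
pose proof (Cmod_ge_0 s).
replace (ln t * (/ t * (Cmod s * Rpower t (- Re s))))
  with (Cmod s * (ln t * (/ t * Rpower t (- Re s)))) by ring.
rewrite Rmult_plus_distr_r, Rmult_1_l, Rmult_assoc.
apply Rplus_le_compat; [exact B|].
apply Rmult_le_compat_l; assumption.
Qed.

Lemma zrem_bound s h t e :
  1 <= t -> 0 < e -> Cmod h <= e ->
  Cmod (zG' (s + h) t - zG' s t - h * zH' s t)%C
  <= (Cmod h * Cmod h) * (/ e + 2 * (Cmod s + e) * (/ e * / e))
     * Rpower t (- (1 + (Re s - 3 * e))).
Proof.
intros Ht He Hh.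
set (L := ln t).
set (r := (Cexp (- h * RtoC L) - 1 - (- h * RtoC L))%C).
replace (zG' (s + h) t - zG' s t - h * zH' s t)%C
  with (RtoC (/ t) * cpow t (- s) * (h * h * RtoC L - (s + h) * r))%C.
2:{ unfold zG', zH'; fold L.
    replace (- (s + h))%C with (- s + - h)%C by ring.
    rewrite cpow_plus.
    replace (cpow t (- h)) with (r + 1 - h * RtoC L)%C; [ring|].
    unfold r, cpow; fold L; ring. }
rewrite !Cmod_mult, Cmod_R, Cmod_cpow by lra.
rewrite Rabs_pos_eq by (left; apply Rinv_0_lt_compat; lra).
replace (Re (- s)) with (- Re s) by (destruct s; reflexivity).
rewrite Rinv_Rpower by lra.
replace (- (1 + (Re s - 3 * e))) with ((-1 + - Re s) + (e + e + e)) by ring.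
rewrite !Rpower_plus.
set (A := Rpower t (-1) * Rpower t (- Re s)).
set (B := Rpower t e).
destruct (ln_le_Rpower t e Ht He) as [L0 L1]; fold L B in L0, L1.
assert (B1 : 1 <= B).
{ unfold B; rewrite <- (Rpower_O t) by lra; apply Rpower_le_exp; lra. }
assert (Hr : Cmod r <= 2 * (Cmod h * Cmod h * (L * L) * B)).
{ unfold r; eapply Rle_trans; [apply Cexp_taylor2|].
  rewrite Cmod_mult, Cmod_opp, Cmod_R, (Rabs_pos_eq L) by exact L0.
  apply Rmult_le_compat_l; [lra|].
  replace (Cmod h * L * (Cmod h * L)) with (Cmod h * Cmod h * (L * L)) by ring.
  apply Rmult_le_compat_l.
  { apply Rmult_le_pos; apply Rmult_le_pos; trivial; apply Cmod_ge_0. }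
  unfold B, Rpower; fold L.
  assert (E : Cmod h * L <= e * L) by (apply Rmult_le_compat_r; trivial).
  destruct E as [E | ->]; [left; apply exp_increasing, E | right; reflexivity]. }
assert (HB : Cmod (h * h * RtoC L - (s + h) * r)%C
  <= Cmod h * Cmod h * (L + 2 * (Cmod s + e) * (L * L * B))).
{ eapply Rle_trans; [apply Cmod_triangle|].
  rewrite Cmod_opp, !Cmod_mult, Cmod_R, (Rabs_pos_eq L) by exact L0.
  assert (S1 : Cmod (s + h) <= Cmod s + e)
    by (eapply Rle_trans; [apply Cmod_triangle | lra]).
  assert (S2 : Cmod (s + h) * Cmod r
    <= (Cmod s + e) * (2 * (Cmod h * Cmod h * (L * L) * B)))
    by (apply Rmult_le_compat; trivial; apply Cmod_ge_0).
  lra. }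
assert (HA : 0 <= A) by (left; apply Rmult_lt_0_compat; apply exp_pos).
match goal with |- _ <= ?q => replace q with (A * (Cmod h * Cmod h *
  ((/ e + 2 * (Cmod s + e) * (/ e * / e)) * (B * B * B)))) by ring end.
apply Rmult_le_compat_l; [exact HA|].
eapply Rle_trans; [exact HB|].
apply Rmult_le_compat_l; [apply Rmult_le_pos; apply Cmod_ge_0|].
rewrite Rmult_plus_distr_r.
assert (He' : 0 < / e) by (apply Rinv_0_lt_compat, He).
assert (LL : L * L <= (/ e * B) * (/ e * B)) by (apply Rmult_le_compat; trivial).
pose proof (Cmod_ge_0 s).
apply Rplus_le_compat.
- eapply Rle_trans; [exact L1|].
  apply Rmult_le_compat_l; [lra|].
  rewrite Rmult_assoc; rewrite <- (Rmult_1_r B) at 1.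
  apply Rmult_le_compat_l; [lra|]; nra.
- rewrite Rmult_assoc; rewrite (Rmult_assoc (2 * _)), (Rmult_assoc 2).
  apply Rmult_le_compat_l; [lra|].
  apply Rmult_le_compat_l; [lra|].
  replace (/ e * / e * (B * B * B)) with ((/ e * B) * (/ e * B) * B) by ring.
  apply Rmult_le_compat_r; lra.
Qed.

Lemma zeta_partial_S (s : C) (N : nat) :
  zeta_partial s (S (S N))
  = ((1 - / (1 - s)) - sum_n (zincr (zP s) (zG s)) N)%C.
Proof.
assert (E : forall n, zeta_partial s (S (S n))
  = (zeta_partial s (S n) - zincr (zP s) (zG s) n)%C).
{ intros n; unfold zeta_partial, zincr, zP, zG.
  rewrite (sum_n_Sm _ 1 (S n)) by lia.
  rewrite !S_INR; change plus with Cplus; unfold Cdiv; ring. }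
assert (E1 : zeta_partial s 1 = (1 - / (1 - s))%C).
{ unfold zeta_partial; rewrite sum_n_n.
  assert (I : forall w, cpow (INR 1) w = RtoC 1).
  { intros w; unfold cpow; simpl INR; rewrite ln_1.
    apply C_eq; destruct w; simpl; rewrite !Rmult_0_r, ?Rminus_0_r, ?Rplus_0_r, exp_0, ?cos_0, ?sin_0; ring. }
  rewrite !I; unfold Cdiv; ring. }
induction N as [|N IH].
- rewrite E, E1, sum_O; reflexivity.
- rewrite E, IH, sum_Sn; change plus with Cplus; ring.
Qed.

Lemma Cmod_series_le (a : nat -> C) (b : nat -> R) (l : C) (lb : R) :
  is_series (V := C_NormedModule) a l -> is_series (V := R_NormedModule) b lb ->
  (forall n, Cmod (a n) <= b n) -> Cmod l <= lb.
Proof.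
intros Ha Hb H.
apply (filterlim_le (F := eventually) (fun n => Cmod (sum_n a n)) (sum_n b)
  (Finite (Cmod l)) (Finite lb)).
- exists 0%nat; intros n _.
  eapply Rle_trans; [apply (norm_sum_n_m (V := C_NormedModule) a 0 n)|].
  apply sum_n_m_le; exact H.
- apply (filterlim_comp _ _ _ _ _ _ _ _ Ha (filterlim_norm (V := C_NormedModule) l)).
- exact Hb.
Qed.

Lemma C1_minus_neq_0 (s : C) : s <> RtoC 1 -> (1 - s)%C <> RtoC 0.
Proof.
intros Hs E; apply Hs; replace s with (1 - (1 - s))%C by ring; rewrite E; ring.
Qed.

Lemma ex_series_zincr (P G G' : R -> C) (M e : R) :
  0 <= M -> 0 < e ->
  (forall t, 1 <= t -> Cder P t (G t)) ->
  (forall t, 1 <= t -> Cder G t (G' t)) ->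
  (forall t, 1 <= t -> Cmod (G' t) <= M * Rpower t (- (1 + e))) ->
  exists l : C, is_series (V := C_NormedModule) (zincr P G) l.
Proof.
intros HM He HP HG HG'.
apply (ex_series_le (V := C_CompleteNormedModule) _
  (fun n => 2 * M * Rpower (INR n + 1) (- (1 + e)))).
- intros n; apply (zincr_bound P G G'); assumption.
- apply (ex_series_scal_l (V := R_NormedModule)), ex_series_Rpower, He.
Qed.

Lemma zeta_series (s : C) :
  0 < Re s -> s <> RtoC 1 ->
  exists A : C,
    is_series (V := C_NormedModule) (zincr (zP s) (zG s)) A
    /\ filterlim (zeta_partial s) eventually (locally (zeta s))
    /\ zeta s = (1 - / (1 - s) - A)%C.
Proof.
intros Hs H1.
destruct (ex_series_zincr (zP s) (zG s) (zG' s) (Cmod s) (Re s)) as [A HA].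
- apply Cmod_ge_0.
- exact Hs.
- intros; apply zP_der; trivial; lra.
- intros; apply zG_der; lra.
- intros; apply zG'_bound; trivial.
- exists A; split; [exact HA|].
  assert (L : filterlim (zeta_partial s) eventually
    (locally ((1 - / (1 - s) - A)%C : C_CompleteNormedModule))).
  { assert (L : filterlim (fun N => zeta_partial s (S (S N))) eventually
      (locally ((1 - / (1 - s) - A)%C : C_CompleteNormedModule))).
    { apply (filterlim_ext (fun N => plus (1 - / (1 - s))%C
        (opp (sum_n (zincr (zP s) (zG s)) N)))).
      { intros N; symmetry; apply zeta_partial_S. }
      eapply (filterlim_comp_2 (G := locally (1 - / (1 - s))%C) (H := locally (opp A))).
      - apply filterlim_const.
      - eapply filterlim_comp; [exact HA|].
        apply (filterlim_opp (V := C_NormedModule)).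
      - apply (filterlim_plus (V := C_NormedModule)). }
    intros P HP; destruct (L P HP) as [N HN].
    exists (S (S N)); intros [|[|n]] Hn; try lia; apply HN; lia. }
  assert (E : zeta s = (1 - / (1 - s) - A)%C).
  { apply (iota_filterlim_locally (V := C_CompleteNormedModule)); exact L. }
  split; [rewrite E; exact L | exact E].
Qed.

Lemma is_lim_Rpower_neg (e : R) :
  0 < e -> is_lim_seq (fun n => Rpower (INR n) (- e)) 0.
Proof.
intros He; unfold Rpower.
apply (filterlim_comp _ _ _ (fun n => - e * ln (INR n)) exp _ (Rbar_locally m_infty)).
- replace m_infty with (Rbar_mult (- e) p_infty).
  + apply (is_lim_seq_scal_l (fun n => ln (INR n)) (- e) p_infty).
    exact (filterlim_comp _ _ _ _ _ _ _ _ is_lim_seq_INR is_lim_ln_p).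
  + unfold Rbar_mult, Rbar_mult'.
    destruct (Rle_dec 0 (- e)) as [H|H]; [exfalso; lra | reflexivity].
- exact is_lim_exp_m.
Qed.

Theorem zeta_Dirichlet_series (s : C) :
  1 < Re s ->
  is_series (V := C_NormedModule) (fun n => cpow (INR (S n)) (- s)) (zeta s).
Proof.
intros Hs.
assert (H1 : s <> RtoC 1) by (intros ->; simpl in Hs; lra).
destruct (zeta_series s ltac:(lra) H1) as [A [_ [L _]]].
assert (Z : filterlim (fun N => cpow (INR N) (1 - s) / (1 - s))%C eventually
  (locally (zero : C_NormedModule))).
{ apply (filterlim_norm_zero (V := C_NormedModule)).
  change (is_lim_seq (fun N => Cmod (cpow (INR N) (1 - s) / (1 - s))) 0).
  apply (is_lim_seq_ext_loc (fun N => / Cmod (1 - s) * Rpower (INR N) (- (Re s - 1)))).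
  { exists 1%nat; intros n Hn.
    assert (0 < INR n) by (apply lt_0_INR; lia).
    rewrite Cmod_div, Cmod_cpow by (trivial; apply C1_minus_neq_0, H1).
    unfold Rdiv; rewrite Rmult_comm; do 2 f_equal; destruct s; simpl; ring. }
  replace (Finite 0) with (Rbar_mult (/ Cmod (1 - s)) 0) by (simpl; f_equal; ring).
  apply is_lim_seq_scal_l, is_lim_Rpower_neg; lra. }
assert (F : filterlim (fun N => plus (zeta_partial s N) (cpow (INR N) (1 - s) / (1 - s))%C)
  eventually (locally (plus (zeta s) (zero : C_NormedModule)))).
{ eapply filterlim_comp_2; [exact L | exact Z |].
  apply (filterlim_plus (V := C_NormedModule)). }
rewrite plus_zero_r in F.
intros P HP; destruct (F P HP) as [N HN].
exists N; intros n Hn.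
match goal with |- P ?x => replace x with (plus (zeta_partial s (S n))
  (cpow (INR (S n)) (1 - s) / (1 - s))%C); [apply HN; lia|] end.
match goal with |- _ = ?r => change r with
  (sum_n_m (G := C_AbelianMonoid) (fun k => cpow (INR (S k)) (- s)) 0 n) end.
rewrite (sum_n_m_S (G := C_AbelianMonoid) (fun k => cpow (INR k) (- s)) 0 n).
unfold zeta_partial; change plus with Cplus.
match goal with |- ?a = ?b => change (@eq C a b) end; ring.
Qed.

Theorem zeta_holomorphic (s : C) :
  0 < Re s -> s <> RtoC 1 ->
  ex_derive (K := C_AbsRing) (V := C_NormedModule) zeta s.
Proof.
intros Hs H1.
set (e := Re s / 4).
assert (He : 0 < e) by (unfold e; lra).
set (d := Cmod (1 - s)).
pose proof (C1_minus_neq_0 s H1) as H1'.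
assert (Hd : 0 < d) by (apply Cmod_gt_0, H1').
destruct (zeta_series s Hs H1) as [A [HA [_ EA]]].
destruct (ex_series_zincr (zQ s) (zH s) (zH' s) (1 + Cmod s * / e) (Re s - e)) as [B HB].
{ assert (0 < / e) by (apply Rinv_0_lt_compat, He).
  pose proof (Cmod_ge_0 s); nra. }
{ unfold e; lra. }
{ intros; apply zQ_der; trivial; lra. }
{ intros; apply zH_der; lra. }
{ intros; apply zH'_bound; trivial. }
destruct (ex_series_Rpower e He) as [W HW].
set (K0 := / e + 2 * (Cmod s + e) * (/ e * / e)).
assert (HK0 : 0 <= K0).
{ assert (0 < / e) by (apply Rinv_0_lt_compat, He).
  pose proof (Cmod_ge_0 s); unfold K0; apply Rplus_le_le_0_compat; [lra|].
  apply Rmult_le_pos; nra. }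
set (K := 2 / (d * d * d) + 2 * K0 * W).
assert (Main : forall h : C, Cmod h <= e -> Cmod h <= d / 2 ->
  Cmod (zeta (s + h) - zeta s - h * (- (/ (1 - s) * / (1 - s)) - B))%C
  <= Cmod h * Cmod h * K).
{ intros h Hh Hh'.
  assert (Hsh : 0 < Re (s + h)).
  { rewrite re_plus; pose proof (re_le_Cmod h) as Q.
    apply Rabs_le_between in Q; unfold e in *; lra. }
  assert (Dh : d / 2 <= Cmod (1 - (s + h))).
  { pose proof (Cmod_triangle (1 - (s + h)) h) as Q.
    replace (1 - (s + h) + h)%C with (1 - s)%C in Q by ring.
    fold d in Q; lra. }
  assert (Hsh1 : (s + h)%C <> RtoC 1).
  { intros E; rewrite E in Dh; replace (1 - 1)%C with (RtoC 0) in Dh by ring.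
    rewrite Cmod_0 in Dh; lra. }
  pose proof (C1_minus_neq_0 _ Hsh1) as Hsh1'.
  destruct (zeta_series (s + h) Hsh Hsh1) as [A' [HA' [_ EA']]].
  rewrite EA, EA'.
  replace (_ - _ - _)%C with
    (- (h * h / ((1 - s) * (1 - s) * (1 - (s + h)))) + - (A' - A - h * B))%C
    by (field; repeat split; assumption).
  eapply Rle_trans; [apply Cmod_triangle|].
  rewrite !Cmod_opp.
  unfold K; rewrite Rmult_plus_distr_l.
  apply Rplus_le_compat.
  - rewrite Cmod_div, !Cmod_mult by (repeat apply Cmult_neq_0; assumption).
    fold d; unfold Rdiv; apply Rmult_le_compat_l; [apply Rmult_le_pos; apply Cmod_ge_0|].
    replace (2 * / (d * d * d)) with (/ (d * d * (d / 2))) by (field; lra).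
    apply Rinv_le_contravar; [repeat apply Rmult_lt_0_compat; lra|].
    apply Rmult_le_compat_l; [apply Rmult_le_pos; lra | exact Dh].
  - apply (Cmod_series_le
      (fun n => zincr (zP (s + h)) (zG (s + h)) n - zincr (zP s) (zG s) n
                - h * zincr (zQ s) (zH s) n)%C
      (fun n => 2 * (Cmod h * Cmod h * K0) * Rpower (INR n + 1) (- (1 + e)))).
    + apply (is_series_minus (V := C_NormedModule)).
      * apply (is_series_minus (V := C_NormedModule)); assumption.
      * apply (is_series_scal_l (V := C_NormedModule)); exact HB.
    + replace (Cmod h * Cmod h * (2 * K0 * W)) with (2 * (Cmod h * Cmod h * K0) * W) by ring.
      apply (is_series_scal_l (V := R_NormedModule)); exact HW.
    + intros n.
      replace (_ - _ - _)%C with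
        (zincr (fun t => zP (s + h) t + (-1 * zP s t + (- h) * zQ s t))%C
               (fun t => zG (s + h) t + (-1 * zG s t + (- h) * zH s t))%C n)
        by (unfold zincr; ring).
      apply (zincr_bound _ _
        (fun t => zG' (s + h) t + (-1 * zG' s t + (- h) * zH' s t))%C); trivial.
      * apply Rmult_le_pos; [apply Rmult_le_pos; apply Cmod_ge_0 | exact HK0].
      * intros; apply (Cder_plus (zP (s + h)));
          [|apply (Cder_plus (fun t => -1 * zP s t)%C (fun t => (- h) * zQ s t)%C);
            [apply (Cder_scal (-1) (zP s)) | apply (Cder_scal (- h) (zQ s))]].
        -- apply zP_der; trivial; lra.
        -- apply zP_der; trivial; lra.
        -- apply zQ_der; trivial; lra.
      * intros; apply (Cder_plus (zG (s + h)));
          [|apply (Cder_plus (fun t => -1 * zG s t)%C (fun t => (- h) * zH s t)%C);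
            [apply (Cder_scal (-1) (zG s)) | apply (Cder_scal (- h) (zH s))]].
        -- apply zG_der; lra.
        -- apply zG_der; lra.
        -- apply zH_der; lra.
      * intros t Ht.
        replace (zG' (s + h) t + (-1 * zG' s t + (- h) * zH' s t))%C
          with (zG' (s + h) t - zG' s t - h * zH' s t)%C by ring.
        eapply Rle_trans; [apply (zrem_bound s h t e Ht He Hh)|].
        replace (Re s - 3 * e) with e by (unfold e; lra).
        right; reflexivity. }
exists (- (/ (1 - s) * / (1 - s)) - B)%C.
split; [apply (is_linear_scal_l (V := C_NormedModule))|].
intros x Hx.
apply (is_filter_lim_locally_unique (V := AbsRing_NormedModule C_AbsRing)) in Hx; subst x.
intros eps.
assert (HK : 0 < Rabs K + 1) by (pose proof (Rabs_pos K); lra).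
assert (Hdel : 0 < Rmin (Rmin e (d / 2)) (eps / (Rabs K + 1))).
{ repeat apply Rmin_pos; try lra.
  apply Rdiv_lt_0_compat; [apply cond_pos | exact HK]. }
exists (mkposreal _ Hdel); intros y Hy.
change (Cmod (y - s)%C < Rmin (Rmin e (d / 2)) (eps / (Rabs K + 1))) in Hy.
pose proof (Rmin_l (Rmin e (d / 2)) (eps / (Rabs K + 1))) as M1.
pose proof (Rmin_r (Rmin e (d / 2)) (eps / (Rabs K + 1))) as M2.
pose proof (Rmin_l e (d / 2)) as M3.
pose proof (Rmin_r e (d / 2)) as M4.
specialize (Main (y - s)%C ltac:(lra) ltac:(lra)).
assert (Ey : forall v : C, (s + (v - s))%C = v) by (intros; ring).
rewrite Ey in Main.
change (Cmod (zeta y - zeta s - (y - s) * (- (/ (1 - s) * / (1 - s)) - B))%C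
  <= eps * Cmod (y - s)%C).
eapply Rle_trans; [exact Main|].
rewrite Rmult_assoc, (Rmult_comm eps).
apply Rmult_le_compat_l; [apply Cmod_ge_0|].
pose proof (Rle_abs K); pose proof (Cmod_ge_0 (y - s)%C).
apply Rle_trans with (eps / (Rabs K + 1) * (Rabs K + 1)).
- apply Rle_trans with (Cmod (y - s)%C * (Rabs K + 1)); [nra|].
  apply Rmult_le_compat_r; lra.
- right; field; lra.
Qed.

(* sigma_{z,beta}(n); for [beta, n >= 1] every [d] with [d^beta | n] is at
   most [n]. *)
Definition divisor_sigma (z : C) (beta n : nat) : C :=
  sum_n_m (fun d : nat =>
             if Nat.eqb (n mod d ^ beta) 0
             then cpow (INR d) (RtoC (INR beta) * z)
             else RtoC 0) 1 n.

Definition nat_floor (x : R) : nat := Z.to_nat (Int_part x).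

(* sum_{n <= x} f n, where for a positive integer [x] the last term is
   counted with weight 1/2 (used for [x > 0]). *)
Definition half_sum (f : nat -> C) (x : R) : C :=
  (sum_n_m f 1 (nat_floor x)
   - (if Req_dec_T x (INR (nat_floor x))
      then / 2 * f (nat_floor x) else 0))%C.

(* Main.v *)
Require Import Defs.
From Stdlib Require Import Reals ZArith Lra Lia List Permutation.
From Coquelicot Require Import Coquelicot.
Open Scope R_scope.

(* Put w = beta z, psi t = t - [t] - 1/2 and y = x^(1/(beta+1)).

   For beta <= 2 the hyperbola method over d^beta m <= x, with d and m cut at y,
   and Euler-Maclaurin summation give the two main terms up to O(1) and
     sum_(d <= y) d^w psi(x/d^beta) + sum_(m <= y) (x/m)^z psi((x/m)^(1/beta)).
   For beta = 2 this is trivially O(y) = O(x^(1/3)).  For beta = 1 it reduces by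
   Abel summation on dyadic blocks to sums of psi(x/n) over n ~ N <= sqrt x,
   which are bounded without exponential sums: Dirichlet approximation of the
   slope x/n^2 by a/q with q <= Q = N/x^(1/3) makes x/n, over q consecutive n, a
   perturbed arithmetic progression of step -a/q, on which psi has sum O(1); a
   block of small q is paid for by the scarcity of n with q x/n^2 within
   O(1/Q) of an integer.

   For beta >= 3 only d <= x^(1/3) contribute, and the error is trivial.

   The half weight at an integer x costs sigma(x)/2, which is O(x^(1/3) log^2 x)
   as a difference of two consecutive values of the summatory function. *)

(** * Finite sums over lists of indices *)

(** The two logarithms have separate origins: one is the harmonic sum over the denominators q when
    blocks are counted, the other is the number of dyadic ranges. The size Q = N / x^(1/3) is, up to
    constants, the largest for which the curvature term q^2 x / n^3 of x/n over a block stays below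
    1/Q, hence below 1/q; counting resonant slopes then leaves O(x^(1/3) log x) blocks, each costing
    O(1). Euler-Maclaurin has to be carried to second order: its remainder at y gets multiplied by
    powers as large as x = y^(beta+1), and only a remainder of order y^(-Re s - 1) brings the
    product down to O(1). [zeta] is usable only for 0 < Re s. The exponent z + 1/beta qualifies once
    beta Re z > -1, but -w may lie on the line Re s = 0; the sums of d^w are therefore compared with
    one another at two endpoints, never with a zeta value. Uniformity in beta holds because beta =
    1, 2 contribute just two constants depending on z, while for beta >= 3 all constants are
    absolute. *)

Definition Rsum (f : nat -> R) (l : list nat) : R :=
  fold_right (fun n s => f n + s) 0 l.

Lemma Rsum_app f l l' : Rsum f (l ++ l') = Rsum f l + Rsum f l'.
Proof. induction l as [|n l IH]; simpl; [|rewrite IH]; ring. Qed.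

Lemma Rsum_seq_S f a n : Rsum f (seq a (S n)) = Rsum f (seq a n) + f (a + n)%nat.
Proof. rewrite seq_S, Rsum_app; simpl; ring. Qed.

Lemma Rsum_ext f g l : (forall n, In n l -> f n = g n) -> Rsum f l = Rsum g l.
Proof.
induction l as [|n l IH]; simpl; intros H; [reflexivity|].
rewrite H, IH; auto.
Qed.

Lemma Rsum_le f g l : (forall n, In n l -> f n <= g n) -> Rsum f l <= Rsum g l.
Proof.
induction l as [|n l IH]; simpl; intros H; [lra|].
apply Rplus_le_compat; auto.
Qed.

Lemma Rsum_plus f g l : Rsum (fun n => f n + g n) l = Rsum f l + Rsum g l.
Proof. induction l as [|n l IH]; simpl; [|rewrite IH]; ring. Qed.

Lemma Rsum_scal c f l : Rsum (fun n => c * f n) l = c * Rsum f l.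
Proof. induction l as [|n l IH]; simpl; [|rewrite IH]; ring. Qed.

Lemma Rsum_const c l : Rsum (fun _ => c) l = c * INR (length l).
Proof. induction l as [|n l IH]; [simpl; ring|cbn [Rsum fold_right length]]. unfold Rsum in IH. rewrite IH, S_INR; ring. Qed.

Lemma Rsum_exchange (f : nat -> nat -> R) l l' :
  Rsum (fun n => Rsum (f n) l') l = Rsum (fun m => Rsum (fun n => f n m) l) l'.
Proof.
induction l as [|n l IH]; simpl.
- symmetry; rewrite Rsum_const; ring.
- rewrite IH, Rsum_plus; reflexivity.
Qed.

Lemma Rsum_triangle f l : Rabs (Rsum f l) <= Rsum (fun n => Rabs (f n)) l.
Proof.
induction l as [|n l IH]; simpl; [rewrite Rabs_R0; lra|].
eapply Rle_trans; [apply Rabs_triang | lra].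
Qed.

Lemma Rsum_map f g l : Rsum f (map g l) = Rsum (fun n => f (g n)) l.
Proof. induction l as [|n l IH]; simpl; [|rewrite IH]; reflexivity. Qed.

(** This is what summing over lists of indices buys: a complete residue system is a permutation of
    [seq 0 q], and intervals are cut into blocks by [seq_app]. *)
Lemma Rsum_perm f l l' : Permutation l l' -> Rsum f l = Rsum f l'.
Proof. induction 1; simpl; lra. Qed.

Lemma Rsum_shift f a n : Rsum f (seq a n) = Rsum (fun r => f (a + r)%nat) (seq 0 n).
Proof. induction n as [|n IH]; [reflexivity|]. rewrite !Rsum_seq_S, IH; reflexivity. Qed.

Lemma Rsum_INR q : Rsum INR (seq 0 q) = INR q * (INR q - 1) / 2.
Proof.
induction q as [|q IH]; [simpl; field|].
rewrite Rsum_seq_S, Nat.add_0_l, IH, S_INR; field.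
Qed.

(** * Integer parts and sums of psi over progressions *)

Lemma Int_part_bounds r : IZR (Int_part r) <= r < IZR (Int_part r) + 1.
Proof. pose proof (base_Int_part r); lra. Qed.

Lemma Int_part_unique r k : IZR k <= r < IZR k + 1 -> Int_part r = k.
Proof.
intros H; pose proof (Int_part_bounds r) as H'.
assert (A : IZR k < IZR (Int_part r + 1)) by (rewrite plus_IZR; lra).
assert (B : IZR (Int_part r) < IZR (k + 1)) by (rewrite plus_IZR; lra).
apply lt_IZR in A; apply lt_IZR in B; lia.
Qed.

Lemma Int_part_le r r' : r <= r' -> IZR (Int_part r) <= IZR (Int_part r').
Proof.
intros H; pose proof (Int_part_bounds r); pose proof (Int_part_bounds r').
assert (A : IZR (Int_part r) < IZR (Int_part r' + 1)) by (rewrite plus_IZR; lra).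
apply lt_IZR in A; apply IZR_le; lia.
Qed.

Lemma nat_floor_bounds t : 0 <= t -> INR (nat_floor t) <= t < INR (nat_floor t) + 1.
Proof.
intros Ht; unfold nat_floor; pose proof (Int_part_bounds t).
assert (0 < IZR (Int_part t + 1)) as P by (rewrite plus_IZR; lra).
apply lt_IZR in P; rewrite INR_IZR_INZ, Z2Nat.id by lia; lra.
Qed.

Lemma nat_floor_unique t n : INR n <= t < INR n + 1 -> nat_floor t = n.
Proof.
intros H; unfold nat_floor; rewrite (Int_part_unique t (Z.of_nat n)).
- apply Nat2Z.id.
- rewrite <- INR_IZR_INZ; exact H.
Qed.

Lemma nat_floor_INR n : nat_floor (INR n) = n.
Proof. apply nat_floor_unique; lra. Qed.

Lemma nat_floor_ge t n : INR n <= t -> (n <= nat_floor t)%nat.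
Proof.
intros H; pose proof (pos_INR n); pose proof (nat_floor_bounds t ltac:(lra)).
apply Nat.lt_succ_r, INR_lt; rewrite S_INR; lra.
Qed.

Lemma nat_floor_lt t n : 0 <= t -> t < INR n -> (nat_floor t < n)%nat.
Proof. intros H0 H; pose proof (nat_floor_bounds t H0); apply INR_lt; lra. Qed.

Lemma Int_part_div c k q :
  (0 < q)%Z -> Int_part (c + IZR k / IZR q) = ((Int_part (IZR q * c) + k) / q)%Z.
Proof.
intros Hq; apply IZR_lt in Hq as Hq'.
set (b := Int_part (IZR q * c)); pose proof (Int_part_bounds (IZR q * c)) as Hb; fold b in Hb.
pose proof (Z.div_mod (b + k) q ltac:(lia)) as D.
pose proof (Z.mod_pos_bound (b + k) q Hq) as M.
set (m := ((b + k) / q)%Z) in *; set (r := ((b + k) mod q)%Z) in *.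
assert (E : IZR b + IZR k = IZR q * IZR m + IZR r)
  by (rewrite <- mult_IZR, <- !plus_IZR; f_equal; exact D).
assert (0 <= IZR r <= IZR q - 1) by (rewrite <- minus_IZR; split; apply IZR_le; lia).
apply Int_part_unique; split.
- apply Rmult_le_reg_l with (IZR q); [lra|].
  replace (IZR q * (c + IZR k / IZR q)) with (IZR q * c + IZR k) by (field; lra); lra.
- apply Rmult_lt_reg_l with (IZR q); [lra|].
  replace (IZR q * (c + IZR k / IZR q)) with (IZR q * c + IZR k) by (field; lra); lra.
Qed.

(** Coprimality makes r -> b + a r injective modulo q, so the remainders permute 0, ..., q - 1. *)
Lemma Rsum_mod (a b : Z) (q : nat) :
  (0 < q)%nat -> Z.gcd a (Z.of_nat q) = 1%Z ->
  Rsum (fun r => IZR ((b + a * Z.of_nat r) mod Z.of_nat q)) (seq 0 q)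
  = INR q * (INR q - 1) / 2.
Proof.
intros Hq G; rewrite <- Rsum_INR.
set (g := fun r => Z.to_nat ((b + a * Z.of_nat r) mod Z.of_nat q)).
rewrite <- (Rsum_perm INR (map g (seq 0 q)) (seq 0 q)).
- rewrite Rsum_map; apply Rsum_ext; intros r _; unfold g.
  pose proof (Z.mod_pos_bound (b + a * Z.of_nat r) (Z.of_nat q) ltac:(lia)).
  rewrite INR_IZR_INZ, Z2Nat.id by lia; reflexivity.
- apply NoDup_Permutation_bis.
  + apply NoDup_map_NoDup_ForallPairs; [|apply seq_NoDup].
    intros r r' Hr Hr' E; unfold g in E; apply in_seq in Hr; apply in_seq in Hr'.
    apply Z2Nat.inj in E; try (apply Z.mod_pos_bound; lia).
    assert (D : (Z.of_nat q | a * (Z.of_nat r - Z.of_nat r'))%Z).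
    { replace (a * (Z.of_nat r - Z.of_nat r'))%Z
        with ((b + a * Z.of_nat r) - (b + a * Z.of_nat r'))%Z by ring.
      apply Z.mod_divide; [lia|].
      rewrite Zminus_mod, E, Z.sub_diag; apply Z.mod_0_l; lia. }
    apply Z.gauss in D; [|rewrite Z.gcd_comm; exact G].
    destruct D as [k Dk].
    assert (k = 0%Z) by (destruct (Z.lt_trichotomy k 0) as [?|[?|?]]; nia).
    subst k; lia.
  + rewrite length_map; reflexivity.
  + intros n Hn; apply in_map_iff in Hn as [r [<- Hr]]; unfold g.
    pose proof (Z.mod_pos_bound (b + a * Z.of_nat r) (Z.of_nat q) ltac:(lia)).
    apply in_seq; lia.
Qed.

(** By [Int_part_div] each floor is the quotient of [q c] + a r by q, that is (dividend - remainder)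
    / q; the remainders run once through all residues, so their sum is known exactly and c enters
    only through [q c]. *)
Lemma floor_sum (a : Z) (q : nat) (c : R) :
  (0 < q)%nat -> Z.gcd a (Z.of_nat q) = 1%Z ->
  Rsum (fun r => IZR (Int_part (c + IZR a * INR r / INR q))) (seq 0 q)
  = IZR (Int_part (INR q * c)) + (IZR a - 1) * (INR q - 1) / 2.
Proof.
intros Hq G; assert (Hq' : 0 < INR q) by (apply lt_0_INR; exact Hq).
set (b := Int_part (INR q * c)).
rewrite (Rsum_ext _ (fun r => / INR q * ((IZR b + IZR a * INR r)
  + - 1 * IZR ((b + a * Z.of_nat r) mod Z.of_nat q)))).
- rewrite Rsum_scal, Rsum_plus, Rsum_plus, Rsum_scal, Rsum_scal, Rsum_const, Rsum_mod, Rsum_INR, length_seq by assumption.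
  field; lra.
- intros r _.
  replace (IZR a * INR r / INR q) with (IZR (a * Z.of_nat r) / IZR (Z.of_nat q))
    by (rewrite mult_IZR, <- !INR_IZR_INZ; reflexivity).
  rewrite Int_part_div by lia.
  rewrite <- INR_IZR_INZ; fold b.
  pose proof (Z.div_mod (b + a * Z.of_nat r) (Z.of_nat q) ltac:(lia)) as D.
  apply (f_equal IZR) in D; rewrite !plus_IZR, !mult_IZR, <- !INR_IZR_INZ in D.
  rewrite D; field; lra.
Qed.

Definition psi (t : R) : R := t - IZR (Int_part t) - / 2.

Lemma psi_bound t : Rabs (psi t) <= / 2.
Proof. unfold psi; pose proof (Int_part_bounds t); apply Rabs_le; lra. Qed.

(* Monotonicity of the floor reduces a perturbed arithmetic progression to
   the two extreme translates, for which [floor_sum] is exact. *)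
Lemma psi_sum_progression (a : Z) (q : nat) (c k : R) (u : nat -> R) :
  (0 < q)%nat -> Z.gcd a (Z.of_nat q) = 1%Z ->
  (forall r, (r < q)%nat -> Rabs (u r - (c + IZR a * INR r / INR q)) <= k / INR q) ->
  Rabs (Rsum (fun r => psi (u r)) (seq 0 q)) <= 2 * k + / 2.
Proof.
intros Hq G H; assert (Hq' : 0 < INR q) by (apply lt_0_INR; exact Hq).
assert (H' : forall r, In r (seq 0 q) -> Rabs (u r - (c + IZR a * INR r / INR q)) <= k / INR q)
  by (intros r Hr; apply H; apply in_seq in Hr; lia).
assert (E : Rsum (fun r => psi (u r)) (seq 0 q)
  = Rsum u (seq 0 q) - Rsum (fun r => IZR (Int_part (u r))) (seq 0 q) - INR q / 2).
{ unfold psi; rewrite (Rsum_ext _ (fun r => u r + (-1 * IZR (Int_part (u r)) + - / 2)))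
    by (intros; ring).
  rewrite !Rsum_plus, Rsum_scal, Rsum_const, length_seq; field. }
assert (S1 : forall e, Rsum (fun r => (c + e / INR q) + IZR a * INR r / INR q) (seq 0 q)
  = INR q * c + e + IZR a * (INR q - 1) / 2).
{ intros e; rewrite (Rsum_ext _ (fun r => (c + e / INR q) + (IZR a / INR q) * INR r))
    by (intros; field; lra).
  rewrite Rsum_plus, Rsum_scal, Rsum_const, Rsum_INR, length_seq; field; lra. }
assert (S2 : forall e, Rsum (fun r => IZR (Int_part ((c + e / INR q) + IZR a * INR r / INR q))) (seq 0 q)
  = IZR (Int_part (INR q * c + e)) + (IZR a - 1) * (INR q - 1) / 2).
{ intros e; rewrite floor_sum by assumption.
  replace (INR q * (c + e / INR q)) with (INR q * c + e) by (field; lra); reflexivity. }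
assert (B : forall r, In r (seq 0 q) ->
  (c + - k / INR q) + IZR a * INR r / INR q <= u r
  <= (c + k / INR q) + IZR a * INR r / INR q).
{ intros r Hr; specialize (H' r Hr); apply Rabs_le_between in H'.
  unfold Rdiv in *; lra. }
pose proof (Rsum_le _ _ (seq 0 q) (fun r Hr => proj1 (B r Hr))) as L1.
pose proof (Rsum_le _ _ (seq 0 q) (fun r Hr => proj2 (B r Hr))) as L2.
pose proof (Rsum_le _ _ (seq 0 q) (fun r Hr => Int_part_le _ _ (proj1 (B r Hr)))) as L3.
pose proof (Rsum_le _ _ (seq 0 q) (fun r Hr => Int_part_le _ _ (proj2 (B r Hr)))) as L4.
rewrite S1 in L1, L2; rewrite S2 in L3, L4.
(* The multiples of a cancel between the sum of [u] and the floor sums, and (q - 1)/2 - q/2 leaves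
   -1/2; replacing a floor at q c - k or q c + k costs at most k + 1 beyond the k already lost,
   whence 2 k + 1/2. *)
pose proof (Int_part_bounds (INR q * c + k)); pose proof (Int_part_bounds (INR q * c + - k)).
rewrite E; apply Rabs_le; lra.
Qed.

(** Pigeonhole: [g] sends the Q + 1 multiples 0, t, ..., Q t to the one of Q boxes of length 1/Q
    that holds their fractional part; two multiples in one box differ by almost an integer. *)
Lemma dirichlet_approx (t : R) (Q : nat) :
  (0 < Q)%nat ->
  exists (q : nat) (a : Z), (1 <= q <= Q)%nat /\ Z.gcd a (Z.of_nat q) = 1%Z
    /\ Rabs (INR q * t - IZR a) <= / INR Q.
Proof.
intros HQ; assert (HQ' : 0 < INR Q) by (apply lt_0_INR; exact HQ).
set (fl := fun k : nat => Int_part (INR k * t)).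
set (g := fun k : nat => Z.to_nat (Int_part (INR Q * (INR k * t - IZR (fl k))))).
assert (Hg : forall k, INR (g k) <= INR Q * (INR k * t - IZR (fl k)) < INR (g k) + 1).
{ intros k; pose proof (Int_part_bounds (INR k * t)) as F; fold (fl k) in F.
  pose proof (Int_part_bounds (INR Q * (INR k * t - IZR (fl k)))) as F'.
  unfold g; rewrite INR_IZR_INZ, Z2Nat.id; [exact F'|].
  assert (P : 0 < IZR (Int_part (INR Q * (INR k * t - IZR (fl k))) + 1))
    by (rewrite plus_IZR; nra).
  apply lt_IZR in P; lia. }
assert (X : exists i j, (i < j <= Q)%nat /\ g i = g j).
{ destruct (ListDec.NoDup_dec Nat.eq_dec (map g (seq 0 (S Q)))) as [N|N].
  - exfalso.
    assert (I : incl (map g (seq 0 (S Q))) (seq 0 Q)).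
    { intros n Hn; apply in_map_iff in Hn as [k [<- Hk]]; apply in_seq; split; [lia|].
      rewrite Nat.add_0_l; apply INR_lt; specialize (Hg k).
      pose proof (Int_part_bounds (INR k * t)) as F; fold (fl k) in F; nra. }
    pose proof (NoDup_incl_length N I) as L; rewrite length_map, !length_seq in L; lia.
  - destruct (Classical_Prop.classic (exists i j, (i < j <= Q)%nat /\ g i = g j)) as [X|X];
      [exact X|exfalso; apply N].
    apply NoDup_map_NoDup_ForallPairs; [|apply seq_NoDup].
    intros i j Hi Hj E; apply in_seq in Hi; apply in_seq in Hj.
    destruct (lt_eq_lt_dec i j) as [[L|L]|L]; [|exact L|].
    + exfalso; apply X; exists i, j; split; [lia|exact E].
    + exfalso; apply X; exists j, i; split; [lia|auto]. }
destruct X as [i [j [Hij E]]].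
set (q0 := (j - i)%nat); set (a0 := (fl j - fl i)%Z).
assert (B : Rabs (INR q0 * t - IZR a0) <= / INR Q).
{ unfold q0, a0; rewrite minus_INR, minus_IZR by lia.
  pose proof (Hg i); pose proof (Hg j); rewrite E in *.
  apply Rmult_le_reg_l with (INR Q); [lra|].
  rewrite Rinv_r, <- (Rabs_pos_eq (INR Q)), <- Rabs_mult by lra.
  apply Rabs_le; rewrite ?(Rabs_pos_eq (INR Q)) by lra; lra. }
pose proof (Z.gcd_nonneg a0 (Z.of_nat q0)) as G0.
assert (G1 : Z.gcd a0 (Z.of_nat q0) <> 0%Z).
{ intros G; apply Z.gcd_eq_0 in G; unfold q0 in G; lia. }
(* Reduction to lowest terms: dividing by the gcd, which is at least 1, increases neither the
   denominator nor the error. *)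
set (d := Z.gcd a0 (Z.of_nat q0)) in *.
destruct (Z.gcd_divide_l a0 (Z.of_nat q0)) as [a Ha]; fold d in Ha.
destruct (Z.gcd_divide_r a0 (Z.of_nat q0)) as [q Hq]; fold d in Hq.
assert (0 < q)%Z by (unfold q0 in *; nia).
exists (Z.to_nat q), a; rewrite Z2Nat.id by lia; split; [|split].
- unfold q0 in *; nia.
- apply (Z.mul_reg_l _ _ d G1); rewrite <- (Z.abs_eq d) at 1 by lia.
  rewrite <- Z.gcd_mul_mono_l.
  rewrite (Z.mul_comm d a), (Z.mul_comm d q), <- Ha, <- Hq; fold d; ring.
- eapply Rle_trans; [|exact B].
  rewrite INR_IZR_INZ, Z2Nat.id by lia.
  rewrite (INR_IZR_INZ q0), Ha, Hq, !mult_IZR.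
  replace (IZR q * IZR d * t - IZR a * IZR d) with (IZR d * (IZR q * t - IZR a)) by ring.
  rewrite Rabs_mult.
  assert (1 <= IZR d) by (apply IZR_le; lia).
  rewrite (Rabs_pos_eq (IZR d)) by lra.
  pose proof (Rabs_pos (IZR q * t - IZR a)); nra.
Qed.

(** * Sums of psi (x / n) over dyadic blocks *)

(* Indicator of the points within [d] of an integer (of every point when [2 * d >= 1]). *)
Definition near (d t : R) : R :=
  if Rle_dec (t + d - IZR (Int_part (t + d))) (2 * d) then 1 else 0.

Lemma near_ge_0 d t : 0 <= near d t.
Proof. unfold near; destruct (Rle_dec _ _); lra. Qed.

Lemma near_integer d t a : Rabs (t - IZR a) <= d -> near d t = 1.
Proof.
intros H; apply Rabs_le_between in H; unfold near.
destruct (Rle_dec _ _) as [|n]; [reflexivity|exfalso; apply n].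
pose proof (Int_part_le (IZR a) (t + d) ltac:(lra)) as I.
rewrite (Int_part_unique (IZR a) a) in I by lra; lra.
Qed.

(* The potential [(2 d + mu) [t + d] + min({t + d}, 2 d + mu)] is nondecreasing
   in [t], and grows by at least [mu] when [t] leaves by a step of at least
   [mu] a point within [d] of an integer. *)
Lemma near_count (u : nat -> R) (d mu : R) (A L : nat) :
  0 <= d -> 0 < mu ->
  (forall n, (A <= n < A + L)%nat -> u n + mu <= u (S n)) ->
  Rsum (fun n => near d (u n)) (seq A L)
  <= (2 * d / mu + 1) * (u (A + L)%nat - u A + 2).
Proof.
intros Hd Hmu Hu.
set (P := fun t => (2 * d + mu) * IZR (Int_part (t + d))
  + Rmin (t + d - IZR (Int_part (t + d))) (2 * d + mu)).
assert (step : forall t t', t + mu <= t' -> mu * near d t <= P t' - P t).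
{ intros t t' H; unfold P, near.
  pose proof (Int_part_bounds (t + d)) as F; pose proof (Int_part_bounds (t' + d)) as F'.
  pose proof (Int_part_le (t + d) (t' + d) ltac:(lra)) as I; apply le_IZR in I.
  destruct (Z.eq_dec (Int_part (t + d)) (Int_part (t' + d))) as [E|E].
  - rewrite <- E in *; unfold Rmin.
    repeat destruct (Rle_dec _ _); lra.
  - assert (I' : (Int_part (t + d) + 1 <= Int_part (t' + d))%Z) by lia.
    apply IZR_le in I'; rewrite plus_IZR in I'.
    assert ((2 * d + mu) * (IZR (Int_part (t + d)) + 1)
      <= (2 * d + mu) * IZR (Int_part (t' + d))) by (apply Rmult_le_compat_l; lra).
    unfold Rmin; repeat destruct (Rle_dec _ _); lra. }
assert (S : forall l, (l <= L)%nat ->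
  mu * Rsum (fun n => near d (u n)) (seq A l) <= P (u (A + l)%nat) - P (u A)).
{ induction l as [|l IH]; intros Hl; [simpl; rewrite Nat.add_0_r; lra|].
  rewrite Rsum_seq_S.
  pose proof (step (u (A + l)%nat) (u (S (A + l))) (Hu (A + l)%nat ltac:(lia))).
  specialize (IH ltac:(lia)); rewrite Nat.add_succ_r; lra. }
apply Rmult_le_reg_l with mu; [exact Hmu|].
eapply Rle_trans; [exact (S L (le_n L))|].
replace (mu * ((2 * d / mu + 1) * (u (A + L)%nat - u A + 2)))
  with ((2 * d + mu) * (u (A + L)%nat - u A + 2)) by (field; lra).
unfold P; pose proof (Int_part_bounds (u (A + L)%nat + d)); pose proof (Int_part_bounds (u A + d)).
pose proof (Rmin_r (u (A + L)%nat + d - IZR (Int_part (u (A + L)%nat + d))) (2 * d + mu)).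
assert (0 <= Rmin (u A + d - IZR (Int_part (u A + d))) (2 * d + mu))
  by (apply Rmin_glb; lra).
nra.
Qed.

(* The weight [1 / q] makes a block of [q] consecutive [n] attached to the
   denominator [q] contribute at least [1]. *)
Definition resonance (x : R) (Q n : nat) : R :=
  Rsum (fun q => / INR q * near (3 / INR Q) (- (INR q * (x / INR n ^ 2)))) (seq 1 Q).

(** All terms of [resonance] are nonnegative, so the one for q suffices. The minus sign inside
    [near] makes its argument increasing in n, as [near_count] requires; this is why the integer
    appears as + a. *)
Lemma resonance_ge (x : R) (Q n q : nat) (a : Z) :
  (1 <= q <= Q)%nat -> Rabs (INR q * (x / INR n ^ 2) + IZR a) <= 3 / INR Q ->
  / INR q <= resonance x Q n.
Proof.
intros Hq H; unfold resonance.
assert (P : forall k, (1 <= k)%nat -> 0 < / INR k)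
  by (intros; apply Rinv_0_lt_compat, lt_0_INR; lia).
assert (G : forall l, (forall k, In k l -> (1 <= k)%nat) ->
  0 <= Rsum (fun q => / INR q * near (3 / INR Q) (- (INR q * (x / INR n ^ 2)))) l).
{ intros l Hl; rewrite <- (Rmult_0_l (INR (length l))), <- Rsum_const.
  apply Rsum_le; intros k Hk; apply Rmult_le_pos; [left; auto | apply near_ge_0]. }
assert (E : seq 1 Q = seq 1 (q - 1) ++ seq q 1 ++ seq (q + 1) (Q - q)).
{ replace q with (1 + (q - 1))%nat at 2 3 by lia; rewrite <- !seq_app; f_equal; lia. }
rewrite E, !Rsum_app.
pose proof (G (seq 1 (q - 1)) ltac:(intros k Hk; apply in_seq in Hk; lia)).
pose proof (G (seq (q + 1) (Q - q)) ltac:(intros k Hk; apply in_seq in Hk; lia)).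
unfold Rsum at 2; cbn [seq fold_right].
rewrite (near_integer _ _ a); [lra|].
replace (- (INR q * (x / INR n ^ 2)) - IZR a) with (- (INR q * (x / INR n ^ 2) + IZR a)) by ring.
rewrite Rabs_Ropp; exact H.
Qed.

(* With [a / q] close to the slope [x / n^2], the [q] values [x / (n + r)] form
   up to [2 / q] an arithmetic progression with step [- a / q]. *)
Lemma psi_block (x : R) (N Q n : nat) :
  0 < x -> (1 <= N <= n)%nat -> (1 <= Q)%nat -> INR Q ^ 3 * x <= INR N ^ 3 ->
  exists q, (1 <= q <= Q)%nat
    /\ Rabs (Rsum (fun k => psi (x / INR k)) (seq n q)) <= 5
    /\ 1 <= Rsum (resonance x Q) (seq n q).
Proof.
intros Hx HN HQ HQN.
destruct (dirichlet_approx (x / INR n ^ 2) Q HQ) as [q [a [Hq [G D]]]].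
assert (Hq1 : 1 <= INR q) by (apply (le_INR 1); lia).
assert (HqQ : INR q <= INR Q) by (apply le_INR; lia).
assert (HN1 : 1 <= INR N) by (apply (le_INR 1); lia).
assert (HNn : INR N <= INR n) by (apply le_INR; lia).
assert (HNn3 : INR N ^ 3 <= INR n ^ 3) by (apply pow_incr; lra).
assert (Hxn : INR q ^ 2 * x <= INR n ^ 3 / INR Q).
{ apply Rmult_le_reg_l with (INR Q); [lra|].
  replace (INR Q * (INR n ^ 3 / INR Q)) with (INR n ^ 3) by (field; lra).
  apply Rle_trans with (INR Q ^ 3 * x); [|lra].
  replace (INR Q ^ 3 * x) with (INR Q * (INR Q ^ 2 * x)) by ring.
  apply Rmult_le_compat_l; [lra|]; apply Rmult_le_compat_r; [lra|].
  apply pow_incr; lra. }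
assert (Hn3 : 0 < INR n ^ 3) by (apply pow_lt; lra).
assert (HQq : / INR Q <= / INR q) by (apply Rinv_le_contravar; lra).
exists q; split; [exact Hq|split].
- rewrite Rsum_shift; apply Rle_trans with (2 * 2 + / 2); [|lra].
  (* Here k = 2: one 1/q pays for the Dirichlet error in the slope, the other for the second-order
     term r^2 x / (n^2 (n + r)). *)
  apply (psi_sum_progression (- a) q (x / INR n)); [lia| |].
  { rewrite Z.gcd_opp_l; exact G. }
  intros r Hr; rewrite opp_IZR, plus_INR.
  assert (Hr0 : 0 <= INR r) by apply pos_INR.
  assert (Hrq : INR r <= INR q) by (apply le_INR; lia).
  replace (x / (INR n + INR r) - (x / INR n + - IZR a * INR r / INR q))
    with (- (INR r / INR q) * (INR q * (x / INR n ^ 2) - IZR a)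
          + (INR r ^ 2 * x) / (INR n ^ 2 * (INR n + INR r))) by (field; lra).
  eapply Rle_trans; [apply Rabs_triang|].
  rewrite Rabs_mult, Rabs_Ropp.
  assert (0 <= INR r / INR q <= 1).
  { split; [apply Rdiv_le_0_compat; lra|].
    apply Rmult_le_reg_r with (INR q); [lra|].
    unfold Rdiv; rewrite Rmult_assoc, Rinv_l; lra. }
  rewrite (Rabs_pos_eq (INR r / INR q)) by lra.
  assert (P : 0 < INR n ^ 2 * (INR n + INR r)) by (apply Rmult_lt_0_compat; [apply pow_lt|]; lra).
  rewrite (Rabs_pos_eq (_ / _)).
  2:{ apply Rdiv_le_0_compat; [|exact P]; apply Rmult_le_pos; [apply pow_le|]; lra. }
  assert (INR r ^ 2 * x / (INR n ^ 2 * (INR n + INR r)) <= / INR Q).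
  { apply Rmult_le_reg_r with (INR n ^ 2 * (INR n + INR r)); [exact P|].
    unfold Rdiv at 1; rewrite Rmult_assoc, Rinv_l, Rmult_1_r by lra.
    apply Rle_trans with (INR q ^ 2 * x); [apply Rmult_le_compat_r; [lra|apply pow_incr; lra]|].
    eapply Rle_trans; [exact Hxn|].
    unfold Rdiv; rewrite Rmult_comm.
    apply Rmult_le_compat_l; [left; apply Rinv_0_lt_compat; lra|].
    assert (0 <= INR n ^ 2 * INR r) by (apply Rmult_le_pos; [apply pow_le|]; lra).
    lra. }
  pose proof (Rabs_pos (INR q * (x / INR n ^ 2) - IZR a)).
  unfold Rdiv at 3; nra.
- apply Rle_trans with (Rsum (fun _ => / INR q) (seq n q)).
  { rewrite Rsum_const, length_seq, Rinv_l; lra. }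
  apply Rsum_le; intros k Hk; apply in_seq in Hk.
  apply (resonance_ge x Q k q (- a)); [exact Hq|].
  rewrite opp_IZR.
  replace k with (n + (k - n))%nat by lia; rewrite plus_INR.
  set (r := INR (k - n)).
  assert (Hr0 : 0 <= r) by apply pos_INR.
  assert (Hrq : r <= INR q) by (apply le_INR; lia).
  assert (Hk0 : 0 < INR n + r) by lra.
  replace (INR q * (x / (INR n + r) ^ 2) + - IZR a)
    with ((INR q * (x / INR n ^ 2) - IZR a)
          + - ((INR q * r * x) * (2 * INR n + r) / (INR n ^ 2 * (INR n + r) ^ 2))) by (field; lra).
  eapply Rle_trans; [apply Rabs_triang|].
  rewrite Rabs_Ropp.
  assert (P : 0 < INR n ^ 2 * (INR n + r) ^ 2) by (apply Rmult_lt_0_compat; apply pow_lt; lra).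
  assert (P1 : 0 <= INR q * r * x) by (repeat apply Rmult_le_pos; lra).
  rewrite (Rabs_pos_eq (_ / _)).
  2:{ apply Rdiv_le_0_compat; [|exact P]; apply Rmult_le_pos; lra. }
  (* Within the block the slope q x / k^2 drifts by at most 2 q^2 x / n^3 <= 2 / Q; with the
     Dirichlet error 1 / Q this gives the width 3 / Q built into [resonance]. *)
  assert (INR q * r * x * (2 * INR n + r) / (INR n ^ 2 * (INR n + r) ^ 2) <= 2 / INR Q).
  { apply Rmult_le_reg_r with (INR n ^ 2 * (INR n + r) ^ 2); [exact P|].
    unfold Rdiv at 1; rewrite Rmult_assoc, Rinv_l, Rmult_1_r by lra.
    apply Rle_trans with (INR n ^ 3 / INR Q * (2 * INR n + r)).
    { apply Rmult_le_compat_r; [lra|]; eapply Rle_trans; [|exact Hxn].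
      apply Rmult_le_compat_r; [lra|]; nra. }
    replace (INR n ^ 3 / INR Q * (2 * INR n + r))
      with (/ INR Q * (INR n ^ 2 * (INR n * (2 * INR n + r)))) by (field; lra).
    replace (2 / INR Q * (INR n ^ 2 * (INR n + r) ^ 2))
      with (/ INR Q * (INR n ^ 2 * (2 * (INR n + r) ^ 2))) by (field; lra).
    apply Rmult_le_compat_l; [left; apply Rinv_0_lt_compat; lra|].
    apply Rmult_le_compat_l; [apply pow_le; lra|].
    nra. }
  unfold Rdiv in *; lra.
Qed.

Lemma psi_sum_trivial (f : nat -> R) (l : list nat) :
  Rabs (Rsum (fun k => psi (f k)) l) <= INR (length l).
Proof.
eapply Rle_trans; [apply Rsum_triangle|].
rewrite <- (Rmult_1_l (INR _)), <- Rsum_const; apply Rsum_le; intros k _.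
pose proof (psi_bound (f k)); lra.
Qed.

(** Blocks from [psi_block] are peeled off greedily; each contributes at most 5 and is paid for by
    its share of resonance, which is at least 1. A last block that does not fit has fewer than Q
    terms and is bounded trivially. *)
Lemma psi_sum_resonance (x : R) (N Q : nat) :
  0 < x -> (1 <= N)%nat -> (1 <= Q)%nat -> INR Q ^ 3 * x <= INR N ^ 3 ->
  forall L n, (N <= n)%nat ->
  Rabs (Rsum (fun k => psi (x / INR k)) (seq n L))
  <= 5 * Rsum (resonance x Q) (seq n L) + INR Q.
Proof.
intros Hx HN HQ HQN L; induction L as [L IH] using (well_founded_induction lt_wf); intros n Hn.
destruct (psi_block x N Q n Hx ltac:(lia) HQ HQN) as [q [Hq [B R]]].
assert (R0 : forall l, 0 <= Rsum (resonance x Q) l).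
{ intros l; rewrite <- (Rmult_0_l (INR (length l))), <- Rsum_const.
  apply Rsum_le; intros k _; unfold resonance.
  rewrite <- (Rmult_0_l (INR (length (seq 1 Q)))), <- Rsum_const.
  apply Rsum_le; intros j Hj; apply in_seq in Hj.
  apply Rmult_le_pos; [left; apply Rinv_0_lt_compat, lt_0_INR; lia | apply near_ge_0]. }
destruct (le_lt_dec q L) as [HL|HL].
- replace L with (q + (L - q))%nat by lia; rewrite seq_app, !Rsum_app.
  specialize (IH (L - q)%nat ltac:(lia) (n + q)%nat ltac:(lia)).
  eapply Rle_trans; [apply Rabs_triang|]; lra.
- eapply Rle_trans; [apply psi_sum_trivial|]; rewrite length_seq.
  assert (INR L <= INR Q) by (apply le_INR; lia).
  specialize (R0 (seq n L)); lra.
Qed.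

Lemma harmonic_le (Q : nat) : (1 <= Q)%nat -> Rsum (fun q => / INR q) (seq 1 Q) <= 1 + ln (INR Q).
Proof.
induction Q as [|Q IH]; [lia|]; intros _.
destruct Q as [|Q]; [simpl; rewrite ln_1; lra|].
rewrite Rsum_seq_S; specialize (IH ltac:(lia)).
replace (1 + S Q)%nat with (S (S Q)) by lia.
set (t := INR (S (S Q))); set (s := INR (S Q)) in *.
assert (E : t = s + 1) by (unfold t, s; rewrite (S_INR (S Q)); reflexivity).
assert (Hs : 1 <= s) by (apply (le_INR 1); lia).
assert (H : ln (s / t) <= s / t - 1).
{ rewrite <- (ln_exp (s / t - 1)); apply ln_le; [apply Rdiv_lt_0_compat; lra|].
  pose proof (exp_ineq1_le (s / t - 1)); lra. }
unfold Rdiv in H; rewrite ln_mult, ln_Rinv in H by (try apply Rinv_0_lt_compat; lra).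
replace (s * / t - 1) with (- / t) in H by (rewrite E; field; lra).
lra.
Qed.

(** After exchanging sums, [near_count] is applied for each q. The variation of q x / n^2 over the
    range is at most q x / N^2, and the weight 1/q turns the sum over q into a harmonic one. *)
Lemma resonance_sum (x : R) (N Q A L : nat) :
  0 < x -> (1 <= N)%nat -> (1 <= Q)%nat -> (N <= A)%nat -> (A + L <= 2 * N)%nat ->
  Rsum (resonance x Q) (seq A L)
  <= (48 * (INR N / INR Q) + INR Q * x / INR N ^ 2
      + 96 * (INR N ^ 3 / (INR Q * x)) + 2) * (1 + ln (INR Q)).
Proof.
intros Hx HN HQ HA HL.
assert (HN1 : 1 <= INR N) by (apply (le_INR 1); lia).
assert (HQ1 : 1 <= INR Q) by (apply (le_INR 1); lia).
assert (HN2 : 0 < INR N ^ 2) by (apply pow_lt; lra).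
assert (HN3 : 0 < INR N ^ 3) by (apply pow_lt; lra).
unfold resonance; rewrite Rsum_exchange.
set (a := 48 * (INR N / INR Q)); set (b := x / INR N ^ 2).
set (c := 96 * (INR N ^ 3 / (INR Q * x))).
assert (Ha : 0 <= a) by (unfold a; apply Rmult_le_pos; [lra|]; apply Rdiv_le_0_compat; lra).
assert (Hb : 0 <= b) by (unfold b; apply Rdiv_le_0_compat; lra).
assert (Hc : 0 <= c).
{ unfold c; apply Rmult_le_pos; [lra|]; apply Rdiv_le_0_compat; [lra|].
  apply Rmult_lt_0_compat; lra. }
apply Rle_trans with (Rsum (fun q => (a + c + 2) * / INR q + b) (seq 1 Q)).
- apply Rsum_le; intros q Hq; apply in_seq in Hq.
  assert (Hq1 : 1 <= INR q) by (apply (le_INR 1); lia).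
  rewrite Rsum_scal.
  (* A lower bound for the step of q x / n^2: it is at least q x / (n + 1)^3, and n + 1 <= 2 N gives
     the 8. Then 2 (3/Q) / mu produces 48 = 2 . 3 . 8, and the summand 2 in [near_count] doubles it
     to 96. *)
  set (mu := INR q * x / (8 * INR N ^ 3)).
  assert (Hmu : 0 < mu).
  { unfold mu; apply Rdiv_lt_0_compat; [apply Rmult_lt_0_compat|]; lra. }
  assert (C := near_count (fun n => - (INR q * (x / INR n ^ 2))) (3 / INR Q) mu A L).
  cbv beta in C.
  assert (C1 : forall n, (A <= n < A + L)%nat ->
    - (INR q * (x / INR n ^ 2)) + mu <= - (INR q * (x / INR (S n) ^ 2))).
  { intros n Hn; rewrite S_INR.
    assert (1 <= INR n) by (apply (le_INR 1); lia).
    assert (HnN : INR (S n) <= INR (2 * N)) by (apply le_INR; lia).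
    rewrite S_INR, mult_INR in HnN; simpl (INR 2) in HnN.
    assert (D : x / (8 * INR N ^ 3) <= x / INR n ^ 2 - x / (INR n + 1) ^ 2).
    { replace (x / INR n ^ 2 - x / (INR n + 1) ^ 2)
        with (x * ((2 * INR n + 1) / (INR n ^ 2 * (INR n + 1) ^ 2))) by (field; lra).
      unfold Rdiv at 1; apply Rmult_le_compat_l; [lra|].
      apply Rle_trans with (/ (INR n + 1) ^ 3).
      - apply Rinv_le_contravar; [apply pow_lt; lra|].
        replace (8 * INR N ^ 3) with ((2 * INR N) ^ 3) by ring.
        apply pow_incr; lra.
      - replace (/ (INR n + 1) ^ 3) with (INR n ^ 2 * / (INR n + 1) * / (INR n ^ 2 * (INR n + 1) ^ 2))
          by (field; lra).
        apply Rmult_le_compat_r.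
        { left; apply Rinv_0_lt_compat, Rmult_lt_0_compat; apply pow_lt; lra. }
        apply Rmult_le_reg_r with (INR n + 1); [lra|].
        rewrite Rmult_assoc, Rinv_l by lra; nra. }
    unfold mu; replace (INR q * x / (8 * INR N ^ 3)) with (INR q * (x / (8 * INR N ^ 3)))
      by (field; lra).
    nra. }
  assert (D3 : 0 <= 3 / INR Q) by (apply Rdiv_le_0_compat; lra).
  specialize (C D3 Hmu C1).
  assert (V : - (INR q * (x / INR (A + L) ^ 2)) - - (INR q * (x / INR A ^ 2)) + 2
    <= INR q * b + 2).
  { assert (HA1 : INR N <= INR A) by (apply le_INR; lia).
    assert (INR A <= INR (A + L)) by (apply le_INR; lia).
    assert (x / INR A ^ 2 <= b).
    { unfold b, Rdiv; apply Rmult_le_compat_l; [lra|].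
      apply Rinv_le_contravar; [exact HN2 | apply pow_incr; lra]. }
    assert (0 <= x / INR (A + L) ^ 2) by (apply Rdiv_le_0_compat; [lra | apply pow_lt; lra]).
    nra. }
  assert (K : 0 <= 2 * (3 / INR Q) / mu + 1).
  { apply Rplus_le_le_0_compat; [apply Rdiv_le_0_compat; lra | lra]. }
  apply Rle_trans with (/ INR q * ((2 * (3 / INR Q) / mu + 1) * (INR q * b + 2))).
  { apply Rmult_le_compat_l; [left; apply Rinv_0_lt_compat; lra|].
    eapply Rle_trans; [exact C|].
    apply Rmult_le_compat_l; assumption. }
  replace (/ INR q * ((2 * (3 / INR Q) / mu + 1) * (INR q * b + 2)))
    with ((a + c * / INR q + 2) * / INR q + b)
    by (unfold a, b, c, mu; field; lra).
  assert (/ INR q <= 1) by (rewrite <- Rinv_1; apply Rinv_le_contravar; lra).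
  assert (0 < / INR q) by (apply Rinv_0_lt_compat; lra).
  apply Rplus_le_compat_r, Rmult_le_compat_r; [lra|]; nra.
- rewrite Rsum_plus, Rsum_scal, Rsum_const, length_seq.
  pose proof (harmonic_le Q HQ) as Hh.
  assert (0 <= ln (INR Q)) by (rewrite <- ln_1; apply ln_le; lra).
  replace (INR Q * x / INR N ^ 2) with (b * INR Q) by (unfold b; field; lra).
  assert (0 <= b * INR Q) by (apply Rmult_le_pos; lra).
  nra.
Qed.

(** With T = x^(1/3) and v = N / T, the choice Q = [v] makes every term of [resonance_sum] O(T): the
    restriction N^2 <= x amounts to v^2 <= T, which controls N^3 / (Q x), of order v^2. When N < T
    the trivial bound already suffices. *)
Lemma psi_sum_dyadic (x T : R) (N A L : nat) :
  1 <= T -> T ^ 3 = x -> (1 <= N)%nat -> INR N ^ 2 <= x ->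
  (N <= A)%nat -> (A + L <= 2 * N)%nat ->
  Rabs (Rsum (fun k => psi (x / INR k)) (seq A L)) <= 1500 * T * (1 + ln x).
Proof.
intros HT Hx HN HNx HA HL.
assert (HN1 : 1 <= INR N) by (apply (le_INR 1); lia).
assert (HT2 : 1 <= T ^ 2) by (apply pow_R1_Rle; lra).
assert (Hx1 : 1 <= x) by (rewrite <- Hx; apply pow_R1_Rle; lra).
assert (Hln : 0 <= ln x) by (rewrite <- ln_1; apply ln_le; lra).
destruct (Rle_dec T (INR N)) as [HTN|HTN].
2:{ eapply Rle_trans; [apply psi_sum_trivial|]; rewrite length_seq.
    assert (INR L <= INR N) by (apply le_INR; lia).
    nra. }
set (v := INR N / T).
assert (Hv : INR N = T * v) by (unfold v; field; lra).
assert (Hv1 : 1 <= v).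
{ apply Rmult_le_reg_l with T; [lra|]; rewrite <- Hv; lra. }
pose proof (nat_floor_bounds v ltac:(lra)) as HQ.
assert (HQ0 : (1 <= nat_floor v)%nat) by (apply nat_floor_ge; simpl; lra).
set (Q := nat_floor v) in *.
assert (HQ1 : 1 <= INR Q) by (apply (le_INR 1); lia).
assert (Hv2 : v ^ 2 <= T).
{ apply Rmult_le_reg_l with (T ^ 2); [lra|].
  replace (T ^ 2 * v ^ 2) with (INR N ^ 2) by (rewrite Hv; ring).
  replace (T ^ 2 * T) with x by (rewrite <- Hx; ring); exact HNx. }
assert (HvT : v <= T) by nra.
assert (HQN : INR Q ^ 3 * x <= INR N ^ 3).
{ rewrite Hv, <- Hx; replace ((T * v) ^ 3) with (v ^ 3 * T ^ 3) by ring.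
  apply Rmult_le_compat_r; [apply pow_le; lra | apply pow_incr; lra]. }
eapply Rle_trans; [apply (psi_sum_resonance x N Q); trivial; lra|].
pose proof (resonance_sum x N Q A L ltac:(lra) HN HQ0 HA HL) as R.
assert (E1 : INR N / INR Q <= 2 * T).
{ apply Rmult_le_reg_r with (INR Q); [lra|].
  unfold Rdiv; rewrite Rmult_assoc, Rinv_l, Rmult_1_r by lra.
  rewrite Hv; nra. }
assert (E2 : INR Q * x / INR N ^ 2 <= T).
{ rewrite Hv, <- Hx; replace (INR Q * T ^ 3 / (T * v) ^ 2) with (T * (INR Q / v ^ 2)) by (field; lra).
  rewrite <- (Rmult_1_r T) at 2; apply Rmult_le_compat_l; [lra|].
  apply Rmult_le_reg_r with (v ^ 2); [apply pow_lt; lra|].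
  unfold Rdiv; rewrite Rmult_assoc, Rinv_l, Rmult_1_r by (apply pow_nonzero; lra); nra. }
assert (E3 : INR N ^ 3 / (INR Q * x) <= 2 * T).
{ rewrite Hv, <- Hx; replace ((T * v) ^ 3 / (INR Q * T ^ 3)) with (v ^ 2 * (v / INR Q)) by (field; lra).
  assert (v / INR Q <= 2).
  { apply Rmult_le_reg_r with (INR Q); [lra|].
    unfold Rdiv; rewrite Rmult_assoc, Rinv_l, Rmult_1_r by lra; lra. }
  assert (0 <= v / INR Q) by (apply Rdiv_le_0_compat; lra).
  nra. }
assert (E4 : ln (INR Q) <= ln x).
{ apply ln_le; [lra|]; rewrite <- Hx; nra. }
assert (0 <= ln (INR Q)) by (rewrite <- ln_1; apply ln_le; lra).
(* 291 = 2 . 48 + 1 + 2 . 96 + 2, from [E1], [E2], [E3] and 2 <= 2 T. Finally 5 . 291 T plus Q <= T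
   stays below 1500 T. *)
assert (R' : Rsum (resonance x Q) (seq A L) <= (291 * T) * (1 + ln x)).
{ eapply Rle_trans; [exact R|].
  apply Rle_trans with ((291 * T) * (1 + ln (INR Q))).
  - apply Rmult_le_compat_r; lra.
  - apply Rmult_le_compat_l; lra. }
nra.
Qed.

(** * Complex sums and Abel summation *)

Definition Csum (f : nat -> C) (l : list nat) : C :=
  fold_right (fun n s => (f n + s)%C) (RtoC 0) l.

Lemma Csum_app f l l' : Csum f (l ++ l') = (Csum f l + Csum f l')%C.
Proof. induction l as [|n l IH]; simpl; [|rewrite IH]; ring. Qed.

Lemma Csum_seq_S f a n : Csum f (seq a (S n)) = (Csum f (seq a n) + f (a + n)%nat)%C.
Proof. rewrite seq_S, Csum_app; simpl; ring. Qed.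

Lemma Csum_ext f g l : (forall n, In n l -> f n = g n) -> Csum f l = Csum g l.
Proof.
induction l as [|n l IH]; simpl; intros H; [reflexivity|].
rewrite H, IH; auto.
Qed.

Lemma Csum_plus f g l : Csum (fun n => (f n + g n)%C) l = (Csum f l + Csum g l)%C.
Proof. induction l as [|n l IH]; simpl; [|rewrite IH]; ring. Qed.

Lemma Csum_minus f g l : Csum (fun n => (f n - g n)%C) l = (Csum f l - Csum g l)%C.
Proof. induction l as [|n l IH]; simpl; [|rewrite IH]; ring. Qed.

Lemma Csum_scal (c : C) f l : Csum (fun n => (c * f n)%C) l = (c * Csum f l)%C.
Proof. induction l as [|n l IH]; simpl; [|rewrite IH]; ring. Qed.

Lemma Csum_const (c : C) l : Csum (fun _ => c) l = (RtoC (INR (length l)) * c)%C.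
Proof.
induction l as [|n l IH]; [simpl; ring|cbn [Csum fold_right length]].
unfold Csum in IH; rewrite IH, S_INR, RtoC_plus; ring.
Qed.

Lemma Csum_RtoC f l : Csum (fun n => RtoC (f n)) l = RtoC (Rsum f l).
Proof. induction l as [|n l IH]; simpl; [|rewrite IH, RtoC_plus]; reflexivity. Qed.

Lemma Csum_exchange (f : nat -> nat -> C) l l' :
  Csum (fun n => Csum (f n) l') l = Csum (fun m => Csum (fun n => f n m) l) l'.
Proof.
induction l as [|n l IH]; simpl.
- rewrite Csum_const; ring.
- rewrite IH, Csum_plus; reflexivity.
Qed.

Lemma Csum_Cmod f l : Cmod (Csum f l) <= Rsum (fun n => Cmod (f n)) l.
Proof.
induction l as [|n l IH]; simpl; [rewrite Cmod_0; lra|].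
eapply Rle_trans; [apply Cmod_triangle | lra].
Qed.

Lemma Csum_Cmod_le f l M : (forall n, In n l -> Cmod (f n) <= M) ->
  Cmod (Csum f l) <= M * INR (length l).
Proof.
intros H; eapply Rle_trans; [apply Csum_Cmod|].
rewrite <- Rsum_const; apply Rsum_le; exact H.
Qed.

Lemma Csum_seq (f : nat -> C) (N : nat) :
  sum_n_m (G := C_AbelianMonoid) f 1 N = Csum f (seq 1 N).
Proof.
induction N as [|N IH].
- rewrite sum_n_m_zero by lia; reflexivity.
- rewrite sum_n_Sm by lia; rewrite IH, Csum_seq_S; reflexivity.
Qed.

(* [f] is compared with a decreasing function [k], componentwise. *)
Lemma Cmod_increment_le (f f' : R -> C) (k k' : R -> R) (a b : R) :
  a <= b ->
  (forall t, a <= t <= b -> Cder f t (f' t)) ->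
  (forall t, a <= t <= b -> is_derive k t (k' t)) ->
  (forall t, a <= t <= b -> Cmod (f' t) <= - k' t) ->
  Cmod (f b - f a)%C <= 2 * (k a - k b).
Proof.
intros Hab Hf Hk Hle.
assert (HC : forall (g : R -> R) (l t : R), is_derive g t l -> continuity_pt g t).
{ intros g l t H; apply continuity_pt_filterlim.
  apply (ex_derive_continuous (K := R_AbsRing) (V := R_NormedModule)); eexists; exact H. }
assert (M : forall p p' : R -> R,
  (forall t, a <= t <= b -> is_derive p t (p' t)) ->
  (forall t, a <= t <= b -> p' t <= - k' t) ->
  p b - p a <= k a - k b).
{ intros p p' Hp Hl.
  assert (D : forall t, a <= t <= b -> is_derive (fun t => p t + k t) t (p' t + k' t)).
  { intros t Ht; exact (is_derive_plus _ _ _ _ _ (Hp t Ht) (Hk t Ht)). }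
  destruct (MVT_gen (fun t => p t + k t) a b (fun t => p' t + k' t)) as [c [Hc E]].
  - intros t; rewrite Rmin_left, Rmax_right by lra; intros; apply D; lra.
  - intros t; rewrite Rmin_left, Rmax_right by lra; intros Ht.
    apply (HC _ (p' t + k' t)), D; lra.
  - rewrite Rmin_left, Rmax_right in Hc by lra.
    specialize (Hl c Hc); nra. }
assert (M2 : forall p p' : R -> R,
  (forall t, a <= t <= b -> is_derive p t (p' t)) ->
  (forall t, a <= t <= b -> Rabs (p' t) <= - k' t) ->
  Rabs (p b - p a) <= k a - k b).
{ intros p p' Hp Hl; apply Rabs_le; split.
  - enough (- p b - - p a <= k a - k b) by lra.
    apply (M (fun t => - p t) (fun t => - p' t)).
    + intros t Ht; exact (is_derive_opp _ _ _ (Hp t Ht)).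
    + intros t Ht; specialize (Hl t Ht); apply Rabs_le_between in Hl; lra.
  - apply (M p p'); [exact Hp|].
    intros t Ht; specialize (Hl t Ht); apply Rabs_le_between in Hl; lra. }
apply Cmod_le_2.
- apply (M2 (fun t => Re (f t)) (fun t => Re (f' t))).
  + intros t Ht; apply Hf, Ht.
  + intros t Ht; eapply Rle_trans; [apply re_le_Cmod | auto].
- apply (M2 (fun t => Im (f t)) (fun t => Im (f' t))).
  + intros t Ht; apply Hf, Ht.
  + intros t Ht; eapply Rle_trans; [apply im_le_Cmod | auto].
Qed.

(** Partial summation in a form suited to induction: the weighted sum is compared with its last
    weight times the plain sum, and each further term changes this discrepancy by at most
    [D * S]. *)
Lemma abel_bound (c : nat -> C) (b : nat -> R) (A : nat) (D S : R) (L : nat) :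
  (forall n, (A <= n <= A + L)%nat -> Cmod (c n) <= 1) ->
  (forall n, (A <= n < A + L)%nat -> Cmod (c (n + 1)%nat - c n)%C <= D) ->
  (forall l, (l <= 1 + L)%nat -> Rabs (Rsum b (seq A l)) <= S) ->
  Cmod (Csum (fun n => (c n * b n)%C) (seq A (1 + L))) <= S * (1 + INR L * D).
Proof.
intros Hc HD HS.
assert (P : forall l, (l <= L)%nat ->
  Cmod (Csum (fun n => (c n * b n)%C) (seq A (1 + l))
        - c (A + l)%nat * Rsum b (seq A (1 + l)))%C <= INR l * D * S).
{ induction l as [|l IH]; intros Hl.
  - simpl; rewrite Nat.add_0_r, Rplus_0_r, Rmult_0_l, Rmult_0_l.
    replace (c A * b A + 0 - c A * b A)%C with (RtoC 0) by ring; rewrite Cmod_0; lra.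
  - specialize (IH ltac:(lia)).
    replace (1 + Datatypes.S l)%nat with (Datatypes.S (1 + l)) by lia.
    rewrite Csum_seq_S, Rsum_seq_S, RtoC_plus.
    replace (A + Datatypes.S l)%nat with (A + l + 1)%nat by lia.
    replace (A + (1 + l))%nat with (A + l + 1)%nat by lia.
    set (n := (A + l)%nat) in *; set (s := Rsum b (seq A (1 + l))) in *.
    set (t := Csum _ _) in *.
    replace (t + c (n + 1)%nat * b (n + 1)%nat - c (n + 1)%nat * (s + b (n + 1)%nat))%C
      with ((t - c n * s) + - ((c (n + 1)%nat - c n) * s))%C by ring.
    eapply Rle_trans; [apply Cmod_triangle|].
    rewrite Cmod_opp, Cmod_mult, Cmod_R, S_INR.
    assert (Hs : Rabs s <= S) by (apply HS; lia).
    assert (Hd : Cmod (c (n + 1)%nat - c n)%C <= D) by (apply HD; unfold n; lia).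
    pose proof (Rabs_pos s); pose proof (Cmod_ge_0 (c (n + 1)%nat - c n)%C).
    assert (Cmod (c (n + 1)%nat - c n)%C * Rabs s <= D * S) by (apply Rmult_le_compat; lra).
    lra. }
specialize (P L (le_n L)).
assert (Hs : Rabs (Rsum b (seq A (1 + L))) <= S) by (apply HS; lia).
assert (Hcl : Cmod (c (A + L)%nat) <= 1) by (apply Hc; lia).
set (t := Csum _ _) in *; set (s := Rsum _ _) in *.
replace t with ((t - c (A + L)%nat * s) + c (A + L)%nat * s)%C by ring.
eapply Rle_trans; [apply Cmod_triangle|].
rewrite Cmod_mult, Cmod_R.
pose proof (Rabs_pos s); pose proof (Cmod_ge_0 (c (A + L)%nat)).
assert (Cmod (c (A + L)%nat) * Rabs s <= 1 * S) by (apply Rmult_le_compat; lra).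
lra.
Qed.

(** Weights varying by A / n change by O(A) in total over a dyadic block, so each block loses only a
    factor 1 + A; summing over the blocks costs the second logarithm. *)
Lemma psi_sum_weighted (x T A : R) (c : nat -> C) (N : nat) :
  1 <= T -> T ^ 3 = x -> INR N ^ 2 <= x -> 0 <= A ->
  (forall n, (1 <= n <= N)%nat -> Cmod (c n) <= 1) ->
  (forall n, (1 <= n < N)%nat -> Cmod (c (n + 1)%nat - c n)%C <= A / INR n) ->
  Cmod (Csum (fun n => (c n * RtoC (psi (x / INR n)))%C) (seq 1 N))
  <= 1500 * (1 + A) * T * (1 + ln x) ^ 2.
Proof.
intros HT Hx HN HA Hc HD.
assert (Hx1 : 1 <= x) by (rewrite <- Hx; apply pow_R1_Rle; lra).
assert (Hln : 0 <= ln x) by (rewrite <- ln_1; apply ln_le; lra).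
set (S := 1500 * T * (1 + ln x)).
assert (HS : 0 <= S) by (unfold S; apply Rmult_le_pos; lra).
assert (Block : forall h n, (h < n <= N)%nat -> (n <= 2 * h + 1)%nat ->
  Cmod (Csum (fun n => (c n * RtoC (psi (x / INR n)))%C) (seq (1 + h) (n - h)))
  <= S * (1 + A)).
{ intros h n Hh Hn.
  assert (H1 : 0 < INR (1 + h)) by (apply lt_0_INR; lia).
  replace (n - h)%nat with (1 + (n - h - 1))%nat by lia.
  eapply Rle_trans.
  - apply (abel_bound c (fun n => psi (x / INR n)) (1 + h) (A / INR (1 + h)) S).
    + intros k Hk; apply Hc; lia.
    + intros k Hk; eapply Rle_trans; [apply HD; lia|].
      unfold Rdiv; apply Rmult_le_compat_l; [exact HA|].
      apply Rinv_le_contravar; [exact H1 | apply le_INR; lia].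
    + intros l Hl; apply (psi_sum_dyadic x T (1 + h)); trivial; try lia.
      eapply Rle_trans; [|exact HN]; apply pow_incr; split; [lra | apply le_INR; lia].
  - apply Rmult_le_compat_l; [exact HS|].
    assert (INR (n - h - 1) <= INR (1 + h)) by (apply le_INR; lia).
    assert (INR (n - h - 1) * (A / INR (1 + h)) <= INR (1 + h) * (A / INR (1 + h))).
    { apply Rmult_le_compat_r; [apply Rdiv_le_0_compat; lra | assumption]. }
    replace (INR (1 + h) * (A / INR (1 + h))) with A in * by (field; lra).
    lra. }
(* Halving n adds one block and lowers ln n by at least ln 2 > 1/2, so 2 ln n pays for it. Since N^2
   <= x, the total 1 + 2 ln N is at most 1 + ln x. *)
assert (Ind : forall n, (1 <= n <= N)%nat ->
  Cmod (Csum (fun n => (c n * RtoC (psi (x / INR n)))%C) (seq 1 n))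
  <= S * (1 + A) * (1 + 2 * ln (INR n))).
{ intros n; induction n as [n IH] using (well_founded_induction lt_wf); intros Hn.
  pose proof (Nat.div_mod_eq n 2) as E; pose proof (Nat.mod_upper_bound n 2 ltac:(lia)).
  set (h := (n / 2)%nat) in *.
  assert (Hh : (h < n <= N)%nat) by lia.
  specialize (Block h n Hh ltac:(lia)).
  assert (0 <= S * (1 + A)) by (apply Rmult_le_pos; lra).
  destruct (Nat.eq_dec h 0) as [h0|h0].
  - replace n with 1%nat in * by lia; rewrite h0 in Block.
    change (1 - 0)%nat with 1%nat in Block; change (1 + 0)%nat with 1%nat in Block.
    change (INR 1) with 1; rewrite ln_1; lra.
  - specialize (IH h ltac:(lia) ltac:(lia)).
    replace (seq 1 n) with (seq 1 h ++ seq (1 + h) (n - h))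
      by (rewrite <- seq_app; f_equal; lia).
    rewrite Csum_app; eapply Rle_trans; [apply Cmod_triangle|].
    assert (Hh1 : 1 <= INR h) by (apply (le_INR 1); lia).
    assert (L : ln (INR h) + ln 2 <= ln (INR n)).
    { rewrite <- ln_mult by lra; apply ln_le; [lra|].
      change 2 with (INR 2); rewrite <- mult_INR; apply le_INR; lia. }
    pose proof ln_lt_2; nra. }
destruct (Nat.eq_dec N 0) as [->|N0].
- simpl; rewrite Cmod_0; repeat apply Rmult_le_pos; lra.
- eapply Rle_trans; [apply Ind; lia|].
  assert (HN1 : 1 <= INR N) by (apply (le_INR 1); lia).
  assert (L : 2 * ln (INR N) <= ln x).
  { replace (2 * ln (INR N)) with (ln (INR N ^ 2)); [apply ln_le; [apply pow_lt|]; lra|].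
    simpl; rewrite Rmult_1_r, ln_mult by lra; lra. }
  replace (1500 * (1 + A) * T * (1 + ln x) ^ 2) with (S * (1 + A) * (1 + ln x))
    by (unfold S; ring).
  apply Rmult_le_compat_l; [apply Rmult_le_pos|]; lra.
Qed.

(** * Euler-Maclaurin summation of n^(-s) *)

Lemma psi_nat_floor t : 0 <= t -> psi t = t - INR (nat_floor t) - / 2.
Proof.
intros Ht; pose proof (nat_floor_bounds t Ht); unfold psi.
rewrite (Int_part_unique t (Z.of_nat (nat_floor t))); rewrite <- INR_IZR_INZ; lra.
Qed.

Lemma cpow_1_l s : cpow 1 s = RtoC 1.
Proof.
unfold cpow; rewrite ln_1; replace (s * 0)%C with (RtoC 0) by ring.
apply C_eq; simpl; rewrite exp_0, ?cos_0, ?sin_0; ring.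
Qed.

Lemma cpow_0_r t : cpow t 0 = RtoC 1.
Proof.
unfold cpow; replace (0 * ln t)%C with (RtoC 0) by ring.
apply C_eq; simpl; rewrite exp_0, ?cos_0, ?sin_0; ring.
Qed.

Lemma cpow_mult_l t u s : 0 < t -> 0 < u -> cpow (t * u) s = (cpow t s * cpow u s)%C.
Proof.
intros Ht Hu; unfold cpow; rewrite ln_mult, RtoC_plus, Cmult_plus_distr_l by assumption.
apply Cexp_plus.
Qed.

Lemma cpow_Rpower t r s : cpow (Rpower t r) s = cpow t (r * s).
Proof. unfold cpow, Rpower; rewrite ln_exp, RtoC_mult; f_equal; ring. Qed.

Lemma cpow_1_r t : 0 < t -> cpow t 1 = RtoC t.
Proof. intros; rewrite cpow_real, Rpower_1; trivial. Qed.

(** Second-order Euler-Maclaurin expression with the floor frozen at n, hence differentiable in t.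
    With v = t - n - 1/2, the factor (v^2 - 1/4)/2 is the antiderivative of v vanishing at both ends
    of [n, n + 1]. All terms of the derivative cancel except one of size t^(-Re s - 2). *)
Definition em_piece (s : C) (n : nat) (t : R) : C :=
  (Csum (fun k => cpow (INR k) (- s)) (seq 1 n) + (-1 * zP s t
   + (RtoC (t - INR n - / 2) * zG s t
      + s * (RtoC (((t - INR n - / 2) ^ 2 - / 4) / 2) * cpow t (- s - 1)))))%C.

Lemma cpow_opp_succ t s : 0 < t -> cpow t (- s) = (t * cpow t (- s - 1))%C.
Proof.
intros Ht; rewrite <- (cpow_1_r t Ht); rewrite <- cpow_plus; f_equal; ring.
Qed.

Lemma em_piece_der s n t : s <> RtoC 1 -> 0 < t ->
  Cder (em_piece s n) t
    (- (s * (s + 1) * RtoC (((t - INR n - / 2) ^ 2 - / 4) / 2)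
        * (RtoC (/ t) * cpow t (- s - 1))))%C.
Proof.
intros Hs Ht; eapply Cder_eq.
- apply Cder_plus; [apply Cder_const|].
  apply Cder_plus; [apply Cder_scal, zP_der; assumption|].
  apply Cder_plus.
  + apply Cder_mult; [|apply zG_der, Ht].
    apply (Cder_RtoC (fun t => t - INR n - / 2) t 1).
    auto_derive; [trivial | ring].
  + apply Cder_scal, Cder_mult; [|apply Cder_cpow, Ht].
    apply (Cder_RtoC (fun t => ((t - INR n - / 2) ^ 2 - / 4) / 2) t (t - INR n - / 2)).
    auto_derive; [trivial | field].
- unfold zG', zG; rewrite (cpow_opp_succ t s Ht), RtoC_inv by lra.
  field; apply RtoC_neq_0; lra.
Qed.

(** Consecutive pieces join without a jump: v drops from 1/2 to -1/2, which offsets the new summand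
    (n + 1)^(-s), and the quadratic factor vanishes on both sides. *)
Lemma em_piece_succ s n :
  em_piece s n (INR (S n)) = em_piece s (S n) (INR (S n)).
Proof.
unfold em_piece; rewrite Csum_seq_S.
replace (1 + n)%nat with (S n) by lia; set (t := INR (S n)).
replace (t - INR n - / 2) with (/ 2) by (unfold t; rewrite S_INR; field).
replace (t - t - / 2) with (- / 2) by ring.
replace ((- / 2) ^ 2) with (/ 4) by field.
replace ((/ 2) ^ 2) with (/ 4) by field.
replace ((/ 4 - / 4) / 2) with 0 by field.
rewrite RtoC_opp; unfold zG.
assert (E : (RtoC (/ 2) + RtoC (/ 2))%C = RtoC 1) by (rewrite <- RtoC_plus; f_equal; field).
transitivity (Csum (fun k => cpow (INR k) (- s)) (seq 1 n)
  + (-1 * zP s t + ((RtoC (/ 2) + RtoC (/ 2)) * cpow t (- s) - RtoC (/ 2) * cpow t (- s))))%C;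
  [ring|]; rewrite E; ring.
Qed.

(** The 8 comes from |v^2 - 1/4| / 2 <= 1/8, the divisor Re s + 1 from integrating t^(-Re s - 2). *)
Definition em_const (s : C) : R := Cmod s * Cmod (s + 1) / 8 / (Re s + 1).

Lemma em_piece_increment s n a b :
  s <> RtoC 1 -> -1 < Re s -> 0 < a -> INR n <= a <= b -> b <= INR n + 1 ->
  Cmod (em_piece s n b - em_piece s n a)%C
  <= 2 * (em_const s * Rpower a (- (Re s + 1)) - em_const s * Rpower b (- (Re s + 1))).
Proof.
intros Hs Hre Ha Hab Hb.
apply (Cmod_increment_le (em_piece s n)
  (fun t => - (s * (s + 1) * RtoC (((t - INR n - / 2) ^ 2 - / 4) / 2)
        * (RtoC (/ t) * cpow t (- s - 1))))%C
  (fun t => em_const s * Rpower t (- (Re s + 1)))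
  (fun t => em_const s * (- (Re s + 1) * Rpower t (- (Re s + 1) - 1))) a b); [lra| | |].
- intros t Ht; apply em_piece_der; [exact Hs | lra].
- intros t Ht.
  apply (is_derive_scal (fun t => Rpower t (- (Re s + 1)))).
  apply is_derive_Reals, derivable_pt_lim_power; lra.
- intros t Ht.
  rewrite Cmod_opp, !Cmod_mult, !Cmod_R, Cmod_cpow by lra.
  rewrite (Rabs_pos_eq (/ t)) by (left; apply Rinv_0_lt_compat; lra).
  rewrite Rinv_Rpower by lra.
  replace (-1 + Re (- s - 1)) with (- (Re s + 1) - 1) by (destruct s; simpl; ring).
  replace (- (em_const s * (- (Re s + 1) * Rpower t (- (Re s + 1) - 1))))
    with (Cmod s * Cmod (s + 1) * / 8 * Rpower t (- (Re s + 1) - 1))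
    by (unfold em_const; field; lra).
  apply Rmult_le_compat_r; [left; apply exp_pos|].
  apply Rmult_le_compat_l; [apply Rmult_le_pos; apply Cmod_ge_0|].
  set (v := t - INR n - / 2); assert (Hv : - / 2 <= v <= / 2) by (unfold v; lra).
  apply Rabs_le; nra.
Qed.

Lemma em_piece_chain s : s <> RtoC 1 -> -1 < Re s ->
  forall j n a b, 0 < a -> INR n <= a <= INR n + 1 ->
  INR (n + j) <= b <= INR (n + j) + 1 -> a <= b ->
  Cmod (em_piece s (n + j) b - em_piece s n a)%C
  <= 2 * (em_const s * Rpower a (- (Re s + 1)) - em_const s * Rpower b (- (Re s + 1))).
Proof.
intros Hs Hre j; induction j as [|j IH]; intros n a b Ha Hn Hb Hab.
- rewrite Nat.add_0_r in *; apply em_piece_increment; lra || assumption.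
- replace (n + S j)%nat with (S (n + j)) in * by lia.
  assert (Hc : a <= INR (S (n + j))).
  { rewrite S_INR, plus_INR; pose proof (pos_INR j); lra. }
  pose proof (IH n a (INR (S (n + j))) Ha Hn ltac:(rewrite (S_INR (n + j)); lra) Hc) as H1.
  pose proof (em_piece_increment s (S (n + j)) (INR (S (n + j))) b Hs Hre
    ltac:(lra) ltac:(lra) ltac:(lra)) as H2.
  rewrite em_piece_succ in H1.
  match goal with |- Cmod (?u - ?v) <= _ => set (U := u) in *; set (V := v) in * end.
  match type of H2 with Cmod (_ - ?w) <= _ => set (W := w) in * end.
  replace (U - V)%C with ((U - W) + (W - V))%C by ring.
  eapply Rle_trans; [apply Cmod_triangle|]; lra.
Qed.

(* Euler-Maclaurin remainder of [sum_(k <= t) k^(-s)]. *)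
Definition em (s : C) (t : R) : C :=
  (Csum (fun k => cpow (INR k) (- s)) (seq 1 (nat_floor t))
   - cpow t (1 - s) / (1 - s) + psi t * cpow t (- s))%C.

(** The two differ exactly by the quadratic correction term, which is itself of the size of the
    remainder. *)
Lemma em_em_piece s t : s <> RtoC 1 -> 1 <= t ->
  Cmod (em s t - em_piece s (nat_floor t) t)%C <= Cmod s * Rpower t (- (Re s + 1)).
Proof.
intros Hs Ht; unfold em, em_piece.
pose proof (nat_floor_bounds t ltac:(lra)) as F.
rewrite psi_nat_floor by lra.
pose proof (C1_minus_neq_0 s Hs).
unfold zP, zG; set (n := nat_floor t) in *.
match goal with |- Cmod ?u <= _ => replace u with
  (- (s * (RtoC (((t - INR n - / 2) ^ 2 - / 4) / 2) * cpow t (- s - 1))))%C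
  by (unfold Cdiv; ring) end.
rewrite Cmod_opp, !Cmod_mult, Cmod_R, Cmod_cpow by lra.
replace (Re (- s - 1)) with (- (Re s + 1)) by (destruct s; simpl; ring).
apply Rmult_le_compat_l; [apply Cmod_ge_0|].
rewrite <- (Rmult_1_l (Rpower _ _)) at 2.
apply Rmult_le_compat_r; [left; apply exp_pos|].
set (v := t - INR n - / 2); assert (Hv : - / 2 <= v <= / 2) by (unfold v; lra).
apply Rabs_le; nra.
Qed.

(** A Cauchy estimate that names no limit, so that it also serves s = -w, whose real part may be
    0. *)
Lemma em_diff s : s <> RtoC 1 -> -1 < Re s ->
  exists K, 0 <= K /\ forall a b, 1 <= a <= b ->
  Cmod (em s b - em s a)%C <= K * Rpower a (- (Re s + 1)).
Proof.
intros Hs Hre; exists (2 * em_const s + 2 * Cmod s).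
assert (K0 : 0 <= em_const s).
{ unfold em_const; apply Rdiv_le_0_compat; [|lra].
  apply Rdiv_le_0_compat; [|lra]; apply Rmult_le_pos; apply Cmod_ge_0. }
pose proof (Cmod_ge_0 s) as M0.
split; [lra|]; intros a b Hab.
pose proof (em_em_piece s a Hs ltac:(lra)) as Ea.
pose proof (em_em_piece s b Hs ltac:(lra)) as Eb.
pose proof (nat_floor_bounds a ltac:(lra)) as Fa.
pose proof (nat_floor_bounds b ltac:(lra)) as Fb.
assert (L : (nat_floor a <= nat_floor b)%nat) by (apply nat_floor_ge; lra).
set (n := nat_floor a) in *; set (m := nat_floor b) in *.
pose proof (em_piece_chain s Hs Hre (m - n) n a b ltac:(lra) ltac:(lra)) as Ch.
replace (n + (m - n))%nat with m in Ch by lia.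
specialize (Ch ltac:(lra) ltac:(lra)).
assert (Rm : Rpower b (- (Re s + 1)) <= Rpower a (- (Re s + 1))).
{ rewrite !Rpower_Ropp; apply Rinv_le_contravar; [apply exp_pos|].
  apply Rle_Rpower_l; lra. }
assert (0 < Rpower b (- (Re s + 1))) by apply exp_pos.
replace (em s b - em s a)%C with ((em s b - em_piece s m b)
  + ((em_piece s m b - em_piece s n a) + - (em s a - em_piece s n a)))%C by ring.
eapply Rle_trans; [apply Cmod_triangle|].
eapply Rle_trans; [apply Rplus_le_compat_l, Cmod_triangle|].
rewrite Cmod_opp; nra.
Qed.

(** With the floor convention [psi] equals -1/2 at an integer, so [em] counts the last term with
    weight 1/2; the other half is restored here. *)
Lemma em_INR s N : (1 <= N)%nat ->
  zeta_partial s N = (em s (INR N) + / 2 * cpow (INR N) (- s))%C.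
Proof.
intros HN; unfold zeta_partial, em; rewrite nat_floor_INR, Csum_seq.
rewrite psi_nat_floor, nat_floor_INR by apply pos_INR.
replace (INR N - INR N - / 2) with (- / 2) by ring.
rewrite RtoC_opp, RtoC_inv by lra; ring.
Qed.

(** The estimate of [em_diff] between a and an integer N, with N tending to infinity: the limit is
    [zeta s] since the half term N^(-s) / 2 vanishes for 0 < Re s. *)
Lemma em_zeta s : s <> RtoC 1 -> 0 < Re s ->
  exists K, 0 <= K /\ forall a, 1 <= a ->
  Cmod (em s a - zeta s)%C <= K * Rpower a (- (Re s + 1)).
Proof.
intros Hs Hre; destruct (em_diff s Hs ltac:(lra)) as [K [K0 HK]].
exists K; split; [exact K0|]; intros a Ha.
destruct (zeta_series s Hre Hs) as [A [_ [L _]]].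
apply le_epsilon; intros eps Heps.
assert (He : 0 < eps / 2) by lra.
destruct (proj1 (filterlim_locally_ball_norm (K := C_AbsRing) (U := C_NormedModule) _ _) L (mkposreal _ He)) as [N1 H1].
pose proof (is_lim_Rpower_neg (Re s) Hre) as Z.
apply is_lim_seq_spec in Z; destruct (Z (mkposreal _ He)) as [N2 H2]; simpl in H2.
set (N := (1 + N1 + N2 + nat_floor a)%nat).
specialize (H1 N ltac:(unfold N; lia)); specialize (H2 N ltac:(unfold N; lia)).
assert (HN : a <= INR N).
{ pose proof (nat_floor_bounds a ltac:(lra)).
  apply Rle_trans with (INR (S (nat_floor a))); [rewrite S_INR; lra|].
  apply le_INR; unfold N; lia. }
specialize (HK a (INR N) ltac:(lra)).
change (Cmod (zeta_partial s N - zeta s)%C < eps / 2) in H1.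
rewrite em_INR in H1 by (unfold N; lia).
rewrite Rminus_0_r, Rabs_pos_eq in H2 by (left; apply exp_pos).
replace (em s a - zeta s)%C with
  (- (em s (INR N) - em s a) + ((em s (INR N) + / 2 * cpow (INR N) (- s) - zeta s)
    + - (/ 2 * cpow (INR N) (- s))))%C by ring.
eapply Rle_trans; [apply Cmod_triangle|].
eapply Rle_trans; [apply Rplus_le_compat_l, Cmod_triangle|].
rewrite !Cmod_opp, Cmod_mult, Cmod_cpow by lra.
replace (Re (- s)) with (- Re s) by (destruct s; reflexivity).
assert (Hh : Cmod (/ 2) = / 2) by (rewrite <- RtoC_inv, Cmod_R, Rabs_pos_eq; lra).
rewrite Hh; lra.
Qed.

(** * The hyperbola method *)

Lemma div_succ X q : (0 < q)%nat ->
  (S X / q = X / q + if Nat.eqb (S X mod q) 0 then 1 else 0)%nat.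
Proof.
intros Hq.
pose proof (Nat.div_mod_eq X q) as D; pose proof (Nat.mod_upper_bound X q ltac:(lia)) as M.
destruct (Nat.eq_dec (S (X mod q)) q) as [E|E].
- assert (H : S X = (q * (X / q + 1) + 0)%nat) by lia.
  rewrite <- (Nat.mod_unique _ _ _ _ Hq H); simpl.
  symmetry; exact (Nat.div_unique _ _ _ _ Hq H).
- assert (H : S X = (q * (X / q) + S (X mod q))%nat) by lia.
  assert (H' : (S (X mod q) < q)%nat) by lia.
  rewrite <- (Nat.mod_unique _ _ _ _ H' H); simpl.
  rewrite Nat.add_0_r; symmetry; exact (Nat.div_unique _ _ _ _ H' H).
Qed.

Lemma pow_pos_nat d b : (1 <= d)%nat -> (0 < d ^ b)%nat.
Proof. intros Hd; apply Nat.neq_0_lt_0, Nat.pow_nonzero; lia. Qed.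

(** Passing from X to X + 1 raises the quotient X / d^b by one exactly when d^b divides X + 1, which
    is the condition selecting d in [divisor_sigma]. *)
Lemma divisor_sum (z : C) (b X : nat) : (1 <= b)%nat ->
  Csum (divisor_sigma z b) (seq 1 X)
  = Csum (fun d => (cpow (INR d) (INR b * z) * INR (X / d ^ b))%C) (seq 1 X).
Proof.
intros Hb; induction X as [|X IH]; [reflexivity|].
rewrite Csum_seq_S, IH; unfold divisor_sigma; rewrite Csum_seq.
(* Extending the range to d = X + 1 is free: (X + 1)^b exceeds X, so the quotient is 0. *)
assert (E : Csum (fun d => (cpow (INR d) (INR b * z) * INR (X / d ^ b))%C) (seq 1 X)
  = Csum (fun d => (cpow (INR d) (INR b * z) * INR (X / d ^ b))%C) (seq 1 (S X))).
{ rewrite Csum_seq_S, (Nat.div_small X); [simpl (INR 0); ring|].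
  pose proof (Nat.pow_le_mono_r (1 + X) 1 b ltac:(lia) Hb) as P.
  rewrite Nat.pow_1_r in P; lia. }
rewrite E; change (1 + X)%nat with (S X).
rewrite <- Csum_plus; apply Csum_ext; intros d Hd; apply in_seq in Hd.
rewrite (div_succ X (d ^ b)), plus_INR, RtoC_plus by (apply pow_pos_nat; lia).
destruct (Nat.eqb _ 0); simpl INR; ring.
Qed.

Lemma count_multiples (X q N : nat) : (0 < q)%nat -> (X / q <= N)%nat ->
  INR (X / q) = Rsum (fun m => if Nat.leb (m * q) X then 1 else 0) (seq 1 N).
Proof.
intros Hq HN.
assert (H : forall n, Rsum (fun m => if Nat.leb (m * q) X then 1 else 0) (seq 1 n)
  = INR (Nat.min n (X / q))).
{ induction n as [|n IH]; [reflexivity|].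
  rewrite Rsum_seq_S, IH.
  destruct (Nat.leb_spec ((1 + n) * q) X) as [L|L].
  - assert ((1 + n) <= X / q)%nat by (apply Nat.div_le_lower_bound; lia).
    rewrite !Nat.min_l by lia; rewrite S_INR; reflexivity.
  - assert (X / q < 1 + n)%nat by (apply Nat.Div0.div_lt_upper_bound; lia).
    rewrite !Nat.min_r by lia; ring. }
rewrite H, Nat.min_r by exact HN; reflexivity.
Qed.

(** For d > N the quotient X / d^b counts cofactors m <= N; exchanging the sums collects, for each
    m, the d with N < d <= [M m], where [M m] is the largest d with m d^b <= X. *)
Lemma hyperbola_nat (f : nat -> C) (b X N : nat) (M : nat -> nat) :
  (N <= X)%nat ->
  (forall d, (N < d)%nat -> (X / d ^ b <= N)%nat) ->
  (forall m, (1 <= m <= N)%nat -> (N <= M m <= X)%nat) ->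
  (forall m d, (1 <= m <= N)%nat -> (m * d ^ b <= X <-> d <= M m)%nat) ->
  Csum (fun d => (f d * INR (X / d ^ b))%C) (seq 1 X)
  = (Csum (fun d => (f d * INR (X / d ^ b))%C) (seq 1 N)
     + Csum (fun m => (Csum f (seq 1 (M m)) - Csum f (seq 1 N))%C) (seq 1 N))%C.
Proof.
intros HX HD HM HMd.
replace (seq 1 X) with (seq 1 N ++ seq (1 + N) (X - N))
  by (rewrite <- seq_app; f_equal; lia).
rewrite Csum_app; f_equal.
rewrite (Csum_ext _ (fun d => Csum (fun m =>
  (f d * RtoC (if Nat.leb (m * d ^ b) X then 1 else 0))%C) (seq 1 N))).
2:{ intros d Hd; apply in_seq in Hd.
    rewrite Csum_scal, Csum_RtoC, <- count_multiples; [reflexivity| |].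
    - apply pow_pos_nat; lia.
    - apply HD; lia. }
rewrite Csum_exchange; apply Csum_ext; intros m Hm; apply in_seq in Hm.
assert (Hm' : (1 <= m <= N)%nat) by lia.
specialize (HM m Hm').
replace (seq 1 (M m)) with (seq 1 N ++ seq (1 + N) (M m - N))
  by (rewrite <- seq_app; f_equal; lia).
replace (seq (1 + N) (X - N)) with (seq (1 + N) (M m - N) ++ seq (1 + M m) (X - M m))
  by (replace (1 + M m)%nat with (1 + N + (M m - N))%nat by lia;
      rewrite <- seq_app; f_equal; lia).
rewrite !Csum_app.
rewrite (Csum_ext _ f (seq (1 + N) (M m - N))).
- rewrite (Csum_ext _ (fun _ => RtoC 0) (seq (1 + M m) (X - M m))).
  + rewrite Csum_const; ring.
  + intros d Hd; apply in_seq in Hd.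
    destruct (Nat.leb_spec (m * d ^ b) X) as [L|L]; [|ring].
    apply HMd in L; lia.
- intros d Hd; apply in_seq in Hd.
  destruct (Nat.leb_spec (m * d ^ b) X) as [L|L]; [ring|].
  assert (d <= M m)%nat as A by lia; apply HMd in A; lia.
Qed.

Lemma nat_floor_div x q : 0 <= x -> (0 < q)%nat ->
  nat_floor (x / INR q) = (nat_floor x / q)%nat.
Proof.
intros Hx Hq; apply nat_floor_unique.
assert (Hq' : 0 < INR q) by (apply lt_0_INR; exact Hq).
pose proof (nat_floor_bounds x Hx) as F.
pose proof (Nat.div_mod_eq (nat_floor x) q) as D.
pose proof (Nat.mod_upper_bound (nat_floor x) q ltac:(lia)) as M.
set (k := (nat_floor x / q)%nat) in *.
assert (L : INR q * INR k <= INR (nat_floor x)) by (rewrite <- mult_INR; apply le_INR; lia).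
assert (U : INR (nat_floor x) + 1 <= INR q * (INR k + 1)).
{ rewrite <- !S_INR, <- mult_INR; apply le_INR; lia. }
split.
- apply Rmult_le_reg_l with (INR q); [lra|].
  replace (INR q * (x / INR q)) with x by (field; lra); lra.
- apply Rmult_lt_reg_l with (INR q); [lra|].
  replace (INR q * (x / INR q)) with x by (field; lra); lra.
Qed.

Lemma pow_lt_compat a c n : 0 <= a < c -> (1 <= n)%nat -> a ^ n < c ^ n.
Proof.
intros H; induction n as [|n IH]; [lia|]; intros _.
destruct n as [|n]; [simpl; lra|].
specialize (IH ltac:(lia)).
change (a * a ^ S n < c * c ^ S n).
assert (0 <= a ^ S n) by (apply pow_le; lra).
nra.
Qed.

Lemma pow_le_inv a c n : 0 <= c -> (1 <= n)%nat -> a ^ n <= c ^ n -> a <= c.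
Proof.
intros Hc Hn H; destruct (Rle_lt_dec a c) as [|L]; [assumption|].
pose proof (pow_lt_compat c a n ltac:(lra) Hn); lra.
Qed.

Definition root (b : nat) (t : R) : R := Rpower t (1 / INR b).

Lemma root_pow b t : (1 <= b)%nat -> 0 < t -> root b t ^ b = t.
Proof.
intros Hb Ht; unfold root.
assert (0 < INR b) by (apply lt_0_INR; lia).
rewrite <- Rpower_pow by apply exp_pos.
rewrite Rpower_mult; replace (1 / INR b * INR b) with 1 by (field; lra).
apply Rpower_1, Ht.
Qed.

Lemma root_ge b m x y : (1 <= b)%nat -> 1 <= y -> x = y ^ S b ->
  0 < INR m <= y -> y <= root b (x / INR m).
Proof.
intros Hb Hy -> Hm.
apply (pow_le_inv _ _ b); [left; apply exp_pos | exact Hb |].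
assert (0 < y ^ S b) by (apply pow_lt; lra).
rewrite root_pow by (assumption || (apply Rdiv_lt_0_compat; lra)).
apply Rmult_le_reg_r with (INR m); [lra|].
replace (y ^ S b / INR m * INR m) with (y ^ b * y) by (simpl; field; lra).
apply Rmult_le_compat_l; [apply pow_le|]; lra.
Qed.

(** Because x = y^b y, a divisor d > y has cofactor at most y, and a cofactor m <= y leaves room for
    d up to (x/m)^(1/b) >= y; one cut therefore serves both variables. *)
Lemma hyperbola_floor (f : nat -> C) (b : nat) (x y : R) :
  (1 <= b)%nat -> 1 <= y -> x = y ^ S b ->
  Csum (fun d => (f d * INR (nat_floor x / d ^ b))%C) (seq 1 (nat_floor x))
  = (Csum (fun d => (f d * INR (nat_floor x / d ^ b))%C) (seq 1 (nat_floor y))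
     + Csum (fun m => (Csum f (seq 1 (nat_floor (root b (x / INR m))))
                       - Csum f (seq 1 (nat_floor y)))%C) (seq 1 (nat_floor y)))%C.
Proof.
intros Hb Hy Hx.
assert (Hyb : 1 <= y ^ b) by (apply pow_R1_Rle; lra).
assert (Hx' : x = y ^ b * y) by (rewrite Hx; simpl; ring).
assert (Hyx : y <= x) by nra.
pose proof (nat_floor_bounds y ltac:(lra)) as Fy.
pose proof (nat_floor_bounds x ltac:(lra)) as Fx.
set (N := nat_floor y) in *; set (X := nat_floor x) in *.
assert (HX : forall k, (k <= X)%nat <-> INR k <= x).
{ intros k; split; intros H.
  - apply le_INR in H; lra.
  - apply nat_floor_ge, H. }
assert (Hm : forall m, (1 <= m <= N)%nat -> 1 <= INR m <= y).
{ intros m Hm; split; [apply (le_INR 1); lia|].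
  assert (INR m <= INR N) by (apply le_INR; lia); lra. }
assert (Hr : forall m, (1 <= m <= N)%nat ->
  0 < root b (x / INR m) /\ INR m * root b (x / INR m) ^ b = x).
{ intros m H; specialize (Hm m H); split; [apply exp_pos|].
  rewrite root_pow; [field; lra | exact Hb | apply Rdiv_lt_0_compat; lra]. }
apply hyperbola_nat.
- apply nat_floor_ge; lra.
- intros d Hd; apply nat_floor_ge.
  assert (Hd' : INR N + 1 <= INR d) by (rewrite <- S_INR; apply le_INR; lia).
  assert (Hdb : y ^ b <= INR d ^ b) by (apply pow_incr; lra).
  set (k := (X / d ^ b)%nat).
  assert (Hk : INR k * INR d ^ b <= x).
  { rewrite <- pow_INR, <- mult_INR; apply HX.
    rewrite Nat.mul_comm; apply Nat.Div0.mul_div_le. }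
  pose proof (pos_INR k).
  apply Rmult_le_reg_r with (y ^ b); [lra|].
  rewrite (Rmult_comm y), <- Hx'; eapply Rle_trans; [|exact Hk].
  apply Rmult_le_compat_l; lra.
- intros m H; specialize (Hm m H); destruct (Hr m H) as [R0 R1].
  pose proof (root_ge b m x y Hb Hy Hx ltac:(lra)) as Hry.
  split; apply nat_floor_ge.
  + lra.
  + pose proof (nat_floor_bounds (root b (x / INR m)) ltac:(lra)) as F.
    eapply Rle_trans; [apply F|].
    apply (pow_le_inv _ _ b); [lra | exact Hb |].
    apply Rmult_le_reg_l with (INR m); [lra|]; rewrite R1.
    assert (x <= x ^ b).
    { rewrite <- (pow_1 x) at 1; apply Rle_pow; [lra | lia]. }
    nra.
- intros m d H; specialize (Hm m H); destruct (Hr m H) as [R0 R1].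
  rewrite HX, mult_INR, pow_INR; split; intros L.
  + apply nat_floor_ge, (pow_le_inv _ _ b); [lra | exact Hb |].
    apply Rmult_le_reg_l with (INR m); [lra|]; rewrite R1; exact L.
  + rewrite <- R1; apply Rmult_le_compat_l; [lra|].
    apply pow_incr; split; [apply pos_INR|].
    apply le_INR in L; pose proof (nat_floor_bounds (root b (x / INR m)) ltac:(lra)); lra.
Qed.

Lemma cpow_div t u s : 0 < t -> 0 < u -> cpow (t / u) s = (cpow t s * cpow u (- s))%C.
Proof.
intros Ht Hu; assert (Hv : 0 < / u) by (apply Rinv_0_lt_compat, Hu).
unfold Rdiv; rewrite cpow_mult_l by assumption; f_equal.
unfold cpow; rewrite ln_Rinv, RtoC_opp by exact Hu; f_equal; ring.
Qed.

Lemma sum_cpow_em s t : s <> RtoC 1 ->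
  Csum (fun k => cpow (INR k) (- s)) (seq 1 (nat_floor t))
  = (em s t + cpow t (1 - s) / (1 - s) - psi t * cpow t (- s))%C.
Proof. intros Hs; unfold em; ring. Qed.

Lemma cpow_INR_exp t n s : 0 < t -> cpow (t ^ n) s = cpow t (INR n * s).
Proof. intros Ht; rewrite <- Rpower_pow, cpow_Rpower by exact Ht; reflexivity. Qed.

Lemma RtoC_pow_cpow t n : 0 < t -> RtoC (t ^ n) = cpow t (INR n).
Proof. intros Ht; rewrite <- Rpower_pow, cpow_real by exact Ht; reflexivity. Qed.

(** The floor of u = x / d^b is written as u - psi u - 1/2. *)
Lemma floor_div_term (z : C) (b d : nat) (x : R) :
  (1 <= d)%nat -> 0 < x ->
  (cpow (INR d) (INR b * z) * INR (nat_floor x / d ^ b))%C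
  = (x * cpow (INR d) (- (INR b - INR b * z))
     - cpow (INR d) (INR b * z) * psi (x / INR d ^ b)
     - / 2 * cpow (INR d) (INR b * z))%C.
Proof.
intros Hd Hx.
assert (Hd0 : 0 < INR d) by (apply lt_0_INR; lia).
assert (Hdb : 0 < INR d ^ b) by (apply pow_lt, Hd0).
rewrite psi_nat_floor by (apply Rlt_le, Rdiv_lt_0_compat; assumption).
rewrite <- pow_INR, nat_floor_div; [|lra | apply pow_pos_nat, Hd].
rewrite pow_INR.
replace (- (INR b - INR b * z))%C with (INR b * z + - INR b)%C by ring.
rewrite cpow_plus.
assert (E : cpow (INR d) (- INR b) = RtoC (/ INR d ^ b)).
{ rewrite <- RtoC_opp, cpow_real, Rpower_Ropp, Rpower_pow by exact Hd0; reflexivity. }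
rewrite E; unfold Rdiv, Rminus.
rewrite !RtoC_plus, !RtoC_opp, RtoC_mult, (RtoC_inv 2) by lra; ring.
Qed.

Definition psi_sum_small (z : C) (b : nat) (x : R) (N : nat) : C :=
  Csum (fun d => (cpow (INR d) (INR b * z) * psi (x / INR d ^ b))%C) (seq 1 N).

(** The contribution of the divisors d > y, indexed by the cofactor m; the exponent z arises because
    the endpoint (x/m)^(1/b) is raised to the power b z. *)
Definition psi_sum_large (z : C) (b : nat) (x : R) (N : nat) : C :=
  Csum (fun m => (cpow (x / INR m) z * psi (root b (x / INR m)))%C) (seq 1 N).

Definition main_term (z : C) (b : nat) (x : R) : C :=
  (zeta (INR b * (1 - z)) * x
   + 1 / (1 + INR b * z) * zeta (z + 1 / INR b) * cpow x (z + 1 / INR b))%C.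

(* All the terms of order [y^(2 + w)] and [y^(1 + w)], [w = b z], cancel. *)
Lemma hyperbola_identity (z : C) (b : nat) (x y : R) :
  (1 <= b)%nat -> 1 <= y -> x = y ^ S b ->
  (1 + INR b * z)%C <> RtoC 0 -> (1 - INR b * (1 - z))%C <> RtoC 0 ->
  let N := nat_floor y in
  let w := (INR b * z)%C in
  Csum (divisor_sigma z b) (seq 1 (nat_floor x))
  = (main_term z b x - psi_sum_small z b x N - psi_sum_large z b x N
     + x * (em (INR b * (1 - z)) y - zeta (INR b * (1 - z)))
     + 1 / (1 + w) * cpow x (z + 1 / INR b) * (em (z + 1 / INR b) y - zeta (z + 1 / INR b))
     + Csum (fun m => (em (- w) (root b (x / INR m)) - em (- w) y)%C) (seq 1 N)
     - / 2 * em (- w) y - psi y * psi y * cpow y w)%C.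
Proof.
intros Hb Hy Hx H1 H2 N w.
assert (Hb0 : 0 < INR b) by (apply lt_0_INR; lia).
assert (Hbc : RtoC (INR b) <> RtoC 0) by (apply RtoC_neq_0; lra).
assert (Hx0 : 0 < x) by (rewrite Hx; apply pow_lt; lra).
set (s1 := (INR b * (1 - z))%C); set (s2 := (z + 1 / INR b)%C).
assert (Hs1 : s1 <> RtoC 1).
{ intros E; apply H2; fold s1; rewrite E; ring. }
assert (Hs2 : s2 <> RtoC 1).
{ intros E; apply H2; replace z with (s2 - 1 / INR b)%C by (unfold s2; ring).
  rewrite E; field; exact Hbc. }
assert (Hw : (- w)%C <> RtoC 1).
{ intros E; apply H1; fold w; replace w with (- - w)%C by ring; rewrite E; ring. }
rewrite divisor_sum, (hyperbola_floor _ b x y) by assumption.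
assert (T1 : Csum (fun d => (cpow (INR d) (INR b * z) * INR (nat_floor x / d ^ b))%C) (seq 1 N)
  = (x * Csum (fun d => cpow (INR d) (- s1)) (seq 1 N) - psi_sum_small z b x N
     - / 2 * Csum (fun d => cpow (INR d) w) (seq 1 N))%C).
{ unfold psi_sum_small; rewrite <- !Csum_scal, <- !Csum_minus.
  apply Csum_ext; intros d Hd; apply in_seq in Hd.
  rewrite floor_div_term by (lia || exact Hx0).
  replace (- (INR b - INR b * z))%C with (- s1)%C by (unfold s1; ring); reflexivity. }
assert (G : forall t, 1 <= t -> Csum (fun d => cpow (INR d) w) (seq 1 (nat_floor t))
  = (em (- w) t + t * cpow t w / (1 + w) - psi t * cpow t w)%C).
{ intros t Ht; pose proof (sum_cpow_em (- w) t Hw) as E.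
  rewrite cpow_1_minus in E by lra.
  replace (- - w)%C with w in E by ring; rewrite E.
  replace (1 - - w)%C with (1 + w)%C by ring; reflexivity. }
assert (T2 : Csum (fun m => (Csum (fun d => cpow (INR d) w) (seq 1 (nat_floor (root b (x / INR m))))
    - Csum (fun d => cpow (INR d) w) (seq 1 N))%C) (seq 1 N)
  = (Csum (fun m => (em (- w) (root b (x / INR m)) - em (- w) y)%C) (seq 1 N)
     + cpow x s2 / (1 + w) * Csum (fun m => cpow (INR m) (- s2)) (seq 1 N)
     - psi_sum_large z b x N
     - INR N * (y * cpow y w / (1 + w) - psi y * cpow y w))%C).
{ assert (E : INR N = INR (length (seq 1 N))) by (rewrite length_seq; reflexivity).
  rewrite E, <- Csum_const; unfold psi_sum_large.
  rewrite <- Csum_scal, <- Csum_plus, <- !Csum_minus.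
  apply Csum_ext; intros m Hm; apply in_seq in Hm.
  assert (Hm1 : 1 <= INR m) by (apply (le_INR 1); lia).
  assert (Hmy : INR m <= y).
  { pose proof (nat_floor_bounds y ltac:(lra)) as F; fold N in F.
    assert (INR m <= INR N) by (apply le_INR; lia); lra. }
  assert (Hxm : 0 < x / INR m) by (apply Rdiv_lt_0_compat; lra).
  assert (Hr : 1 <= root b (x / INR m)).
  { pose proof (root_ge b m x y Hb Hy Hx ltac:(lra)); lra. }
  unfold N; rewrite (G y Hy), (G _ Hr).
  assert (E1 : cpow (root b (x / INR m)) w = cpow (x / INR m) z).
  { unfold root; rewrite cpow_Rpower; f_equal; unfold w.
    rewrite RtoC_div by lra; field; exact Hbc. }
  assert (E2 : (root b (x / INR m) * cpow (root b (x / INR m)) w)%C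
    = (cpow x s2 * cpow (INR m) (- s2))%C).
  { rewrite <- (cpow_1_r (root b (x / INR m))) at 1 by lra.
    rewrite <- cpow_plus; unfold root; rewrite cpow_Rpower, <- cpow_div by lra.
    f_equal; unfold w, s2; rewrite RtoC_div by lra; field; exact Hbc. }
  rewrite E2, E1; unfold Cdiv; ring. }
(* With x = y^(b+1), every boundary power of the two Euler-Maclaurin expansions at y becomes y^(2+w)
   or y^(1+w). *)
assert (P1 : (x * cpow y (1 - s1))%C = (y * (y * cpow y w))%C).
{ rewrite Hx, RtoC_pow_cpow, <- cpow_plus, S_INR, RtoC_plus by lra.
  rewrite <- (cpow_1_r y) by lra; rewrite <- !cpow_plus.
  f_equal; unfold s1, w; ring. }
assert (P2 : (x * cpow y (- s1))%C = (y * cpow y w)%C).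
{ rewrite Hx, RtoC_pow_cpow, <- cpow_plus, S_INR, RtoC_plus by lra.
  rewrite <- (cpow_1_r y) by lra; rewrite <- !cpow_plus.
  f_equal; unfold s1, w; ring. }
assert (P3 : (cpow x s2 * cpow y (1 - s2))%C = (y * (y * cpow y w))%C).
{ rewrite Hx, cpow_INR_exp, <- cpow_plus, S_INR, RtoC_plus by lra.
  rewrite <- (cpow_1_r y) by lra; rewrite <- !cpow_plus.
  f_equal; unfold s2, w; field; exact Hbc. }
assert (P4 : (cpow x s2 * cpow y (- s2))%C = (y * cpow y w)%C).
{ rewrite Hx, cpow_INR_exp, <- cpow_plus, S_INR, RtoC_plus by lra.
  rewrite <- (cpow_1_r y) by lra; rewrite <- !cpow_plus.
  f_equal; unfold s2, w; field; exact Hbc. }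
fold w in T1; fold N w; rewrite T1, T2.
unfold N at 1; rewrite (sum_cpow_em s1 y Hs1).
unfold N at 2; rewrite (G y Hy).
unfold N at 3; rewrite (sum_cpow_em s2 y Hs2).
assert (EN : RtoC (INR N) = (y - psi y - / 2)%C).
{ rewrite psi_nat_floor by lra; fold N.
  rewrite !RtoC_minus, RtoC_inv by lra; ring. }
rewrite EN; unfold main_term; fold s1 s2 w.
replace (x * (em s1 y + cpow y (1 - s1) / (1 - s1) - psi y * cpow y (- s1)))%C
  with (x * em s1 y + x * cpow y (1 - s1) / (1 - s1) - psi y * (x * cpow y (- s1)))%C
  by (unfold Cdiv; ring).
replace (cpow x s2 / (1 + w) * (em s2 y + cpow y (1 - s2) / (1 - s2) - psi y * cpow y (- s2)))%C
  with (cpow x s2 / (1 + w) * em s2 y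
    + (cpow x s2 * cpow y (1 - s2)) / (1 + w) / (1 - s2)
    - psi y * (cpow x s2 * cpow y (- s2)) / (1 + w))%C
  by (unfold Cdiv; ring).
rewrite P1, P2, P3, P4.
(* A partial fraction resting on s1 + w = b and 1 - s2 = (s1 - 1) / b; it makes the three terms in
   y^(2+w) cancel. *)
assert (D : (RtoC 1 / (1 + w) / (1 - s2))%C = (1 / (1 + w) - 1 / (1 - s1))%C).
{ assert (H3 : (1 - s2)%C <> RtoC 0) by (apply C1_minus_neq_0, Hs2).
  revert H1 H2 H3; unfold w, s1, s2; intros.
  field; repeat split; trivial.
  intros E; apply H3; rewrite <- (Cmult_0_l (/ INR b)), <- E; field; exact Hbc. }
replace (y * (y * cpow y w) / (1 + w) / (1 - s2))%C
  with (y * (y * cpow y w) * (1 / (1 + w) / (1 - s2)))%C by (unfold Cdiv; ring).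
rewrite D.
assert (H1' : (1 + w)%C <> RtoC 0) by exact H1.
assert (H2' : (1 - s1)%C <> RtoC 0) by exact H2.
generalize (em s1 y) (em s2 y) (em (- w) y) (zeta s1) (zeta s2) (cpow x s2) (cpow y w).
intros; field; split; assumption.
Qed.

(** * Error bounds *)

Lemma Rpower_le_1 t r : 1 <= t -> r <= 0 -> Rpower t r <= 1.
Proof.
intros Ht Hr; apply Rle_trans with (Rpower t 0); [apply Rpower_le_exp; assumption|].
rewrite Rpower_O; lra.
Qed.

(** All remainders balance at y: x y^(-(Re s1 + 1)) and x^(Re s2) y^(-(Re s2 + 1)) both equal y^(b
    Re z) <= 1, and the sum over m has at most y terms of size O(1/y). *)
Lemma hyperbola_bound (z : C) (b : nat) :
  (1 <= b)%nat -> -1 < INR b * Re z -> Re z <= 0 ->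
  (1 - INR b * (1 - z))%C <> RtoC 0 ->
  exists K, forall x y, 1 <= y -> x = y ^ S b ->
  Cmod (Csum (divisor_sigma z b) (seq 1 (nat_floor x)) - main_term z b x)%C
  <= K + Cmod (psi_sum_small z b x (nat_floor y)) + Cmod (psi_sum_large z b x (nat_floor y)).
Proof.
intros Hb Hw Hz H2.
assert (Hb1 : 1 <= INR b) by (apply (le_INR 1); exact Hb).
assert (Hbc : RtoC (INR b) <> RtoC 0) by (apply RtoC_neq_0; lra).
set (w := (INR b * z)%C).
assert (Rw : Re w = INR b * Re z) by (unfold w; destruct z; simpl; ring).
assert (H1 : (1 + w)%C <> RtoC 0).
{ intros E; apply (f_equal Re) in E; rewrite re_plus, Rw in E; simpl in E; lra. }
set (s1 := (INR b * (1 - z))%C); set (s2 := (z + 1 / INR b)%C).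
assert (R1 : Re s1 = INR b - INR b * Re z) by (unfold s1; destruct z; simpl; ring).
assert (R2 : Re s2 = Re z + / INR b).
{ unfold s2; rewrite re_plus, <- RtoC_div by lra; simpl; field; lra. }
(* The bound -1 < b Re z enters: it puts s2 in the half-plane where [zeta] is meaningful, and above
   it kept 1 + w away from 0. *)
assert (R2' : 0 < Re s2).
{ rewrite R2; apply Rmult_lt_reg_l with (INR b); [lra|].
  replace (INR b * (Re z + / INR b)) with (INR b * Re z + 1) by (field; lra); lra. }
assert (Hs1 : s1 <> RtoC 1).
{ intros E; apply H2; fold s1; rewrite E; ring. }
assert (Hs2 : s2 <> RtoC 1).
{ intros E; apply H2; replace z with (s2 - 1 / INR b)%C by (unfold s2; ring).
  rewrite E; field; exact Hbc. }
assert (Rmw : Re (- w) = - (INR b * Re z)) by (rewrite <- Rw; destruct w; reflexivity).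
assert (Hmw : (- w)%C <> RtoC 1).
{ intros E; apply H1; replace w with (- - w)%C by ring; rewrite E; ring. }
destruct (em_zeta s1 Hs1 ltac:(nra)) as [K1 [K1p HK1]].
destruct (em_zeta s2 Hs2 R2') as [K2 [K2p HK2]].
destruct (em_diff (- w) Hmw ltac:(nra)) as [K3 [K3p HK3]].
set (q := Cmod (1 / (1 + w))).
assert (Hq : 0 <= q) by apply Cmod_ge_0.
set (e := Cmod (em (- w) 1)).
exists (K1 + q * K2 + K3 + (e + K3) + 1).
intros x y Hy Hx.
assert (Hxy : x = Rpower y (INR b + 1)).
{ rewrite Hx, <- Rpower_pow, S_INR by lra; reflexivity. }
assert (Hx0 : 0 < x) by (rewrite Hxy; apply exp_pos).
rewrite (hyperbola_identity z b x y Hb Hy Hx H1 H2).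
fold w s1 s2; set (N := nat_floor y).
pose proof (nat_floor_bounds y ltac:(lra)) as F; fold N in F.
assert (B1 : Cmod (x * (em s1 y - zeta s1)) <= K1).
{ rewrite Cmod_mult, Cmod_R, Rabs_pos_eq by lra.
  apply Rle_trans with (x * (K1 * Rpower y (- (Re s1 + 1)))).
  - apply Rmult_le_compat_l; [lra | apply HK1, Hy].
  - replace (x * (K1 * Rpower y (- (Re s1 + 1))))
      with (K1 * Rpower y (INR b + 1 + - (Re s1 + 1))) by (rewrite Rpower_plus, <- Hxy; ring).
    rewrite <- (Rmult_1_r K1) at 2; apply Rmult_le_compat_l; [exact K1p|].
    apply Rpower_le_1; nra. }
assert (B2 : Cmod (1 / (1 + w) * cpow x s2 * (em s2 y - zeta s2)) <= q * K2).
{ rewrite !Cmod_mult, Cmod_cpow by exact Hx0; fold q.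
  rewrite Rmult_assoc; apply Rmult_le_compat_l; [exact Hq|].
  apply Rle_trans with (Rpower x (Re s2) * (K2 * Rpower y (- (Re s2 + 1)))).
  - apply Rmult_le_compat_l; [left; apply exp_pos | apply HK2, Hy].
  - replace (Rpower x (Re s2) * (K2 * Rpower y (- (Re s2 + 1))))
      with (K2 * Rpower y ((INR b + 1) * Re s2 + - (Re s2 + 1)))
      by (rewrite Rpower_plus, <- Rpower_mult, <- Hxy; ring).
    rewrite <- (Rmult_1_r K2) at 2; apply Rmult_le_compat_l; [exact K2p|].
    apply Rpower_le_1; [exact Hy|].
    replace ((INR b + 1) * Re s2 + - (Re s2 + 1)) with (INR b * Re z); [nra|].
    rewrite R2; field; lra. }
assert (P : Rpower y (- (Re (- w) + 1)) <= / y).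
{ rewrite Rmw, Rpower_Ropp; apply Rinv_le_contravar; [lra|].
  rewrite <- (Rpower_1 y) at 1 by lra; apply Rpower_le_exp; nra. }
assert (Hiy : 0 < / y <= 1).
{ split; [apply Rinv_0_lt_compat; lra|].
  rewrite <- Rinv_1; apply Rinv_le_contravar; lra. }
assert (B3 : Cmod (Csum (fun m => em (- w) (root b (x / INR m)) - em (- w) y)%C (seq 1 N)) <= K3).
{ eapply Rle_trans; [apply (Csum_Cmod_le _ _ (K3 * / y))|].
  - intros m Hm; apply in_seq in Hm.
    assert (Hm1 : 1 <= INR m) by (apply (le_INR 1); lia).
    assert (Hmy : INR m <= INR N) by (apply le_INR; lia).
    pose proof (root_ge b m x y Hb Hy Hx ltac:(lra)).
    eapply Rle_trans; [apply HK3; lra|].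
    apply Rmult_le_compat_l; assumption.
  - rewrite length_seq, Rmult_assoc; rewrite <- (Rmult_1_r K3) at 2.
    apply Rmult_le_compat_l; [exact K3p|].
    apply Rmult_le_reg_l with y; [lra|].
    rewrite <- Rmult_assoc, Rinv_r by lra; lra. }
assert (B4 : Cmod (em (- w) y) <= e + K3).
{ replace (em (- w) y) with (em (- w) 1 + (em (- w) y - em (- w) 1))%C by ring.
  eapply Rle_trans; [apply Cmod_triangle|]; fold e.
  apply Rplus_le_compat_l; eapply Rle_trans; [apply (HK3 1 y); lra|].
  rewrite <- (Rmult_1_r K3) at 2; apply Rmult_le_compat_l; [exact K3p|].
  apply Rpower_le_1; nra. }
assert (Hh : Cmod (/ 2) = / 2) by (rewrite <- RtoC_inv, Cmod_R, Rabs_pos_eq; lra).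
assert (B4' : Cmod (/ 2 * em (- w) y) <= e + K3).
{ rewrite Cmod_mult, Hh; pose proof (Cmod_ge_0 (em (- w) y)); lra. }
assert (B5 : Cmod (psi y * psi y * cpow y w) <= 1).
{ rewrite !Cmod_mult, !Cmod_R, Cmod_cpow by lra.
  pose proof (psi_bound y); pose proof (Rabs_pos (psi y)).
  assert (Rpower y (Re w) <= 1) by (apply Rpower_le_1; nra).
  assert (0 < Rpower y (Re w)) by apply exp_pos.
  assert (Rabs (psi y) * Rabs (psi y) <= 1) by nra.
  nra. }
match goal with |- Cmod ?u <= _ => replace u with
  ((x * (em s1 y - zeta s1) + (1 / (1 + w) * cpow x s2 * (em s2 y - zeta s2)
    + Csum (fun m => em (- w) (root b (x / INR m)) - em (- w) y)%C (seq 1 N)))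
   + - (/ 2 * em (- w) y + (psi y * psi y * cpow y w
        + (psi_sum_small z b x N + psi_sum_large z b x N))))%C by ring end.
eapply Rle_trans; [apply Cmod_triangle|].
rewrite Cmod_opp.
pose proof (Cmod_triangle (x * (em s1 y - zeta s1)) (1 / (1 + w) * cpow x s2 * (em s2 y - zeta s2)
    + Csum (fun m => em (- w) (root b (x / INR m)) - em (- w) y)%C (seq 1 N))).
pose proof (Cmod_triangle (1 / (1 + w) * cpow x s2 * (em s2 y - zeta s2))
    (Csum (fun m => em (- w) (root b (x / INR m)) - em (- w) y)%C (seq 1 N))).
pose proof (Cmod_triangle (/ 2 * em (- w) y) (psi y * psi y * cpow y w
        + (psi_sum_small z b x N + psi_sum_large z b x N))).
pose proof (Cmod_triangle (psi y * psi y * cpow y w)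
        (psi_sum_small z b x N + psi_sum_large z b x N)).
pose proof (Cmod_triangle (psi_sum_small z b x N) (psi_sum_large z b x N)).
lra.
Qed.

Lemma cpow_increment s M a c : 0 < a <= c ->
  (forall t, a <= t <= c -> Rpower t (Re s - 1) <= M) ->
  Cmod (cpow c s - cpow a s)%C <= 2 * (Cmod s * M * (c - a)).
Proof.
intros Hac HM.
replace (Cmod s * M * (c - a)) with (- (Cmod s * M) * a - - (Cmod s * M) * c) by ring.
apply (Cmod_increment_le (fun t => cpow t s) (fun t => RtoC (/ t) * (s * cpow t s))%C
  (fun t => - (Cmod s * M) * t) (fun _ => - (Cmod s * M))); [lra| | |].
- intros t Ht; apply Cder_cpow; lra.
- intros t Ht; auto_derive; [trivial | ring].
- intros t Ht; rewrite !Cmod_mult, Cmod_R, Cmod_cpow by lra.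
  rewrite Rabs_pos_eq by (left; apply Rinv_0_lt_compat; lra).
  replace (/ t * (Cmod s * Rpower t (Re s))) with (Cmod s * (/ t * Rpower t (Re s))) by ring.
  rewrite Rinv_Rpower, Ropp_involutive by lra.
  apply Rmult_le_compat_l; [apply Cmod_ge_0|].
  replace (-1 + Re s) with (Re s - 1) by ring; apply HM, Ht.
Qed.

Lemma psi_sum_small_trivial z b x N : Re z <= 0 ->
  Cmod (psi_sum_small z b x N) <= INR N.
Proof.
intros Hz; unfold psi_sum_small.
rewrite <- (Rmult_1_l (INR N)), <- (length_seq N 1).
rewrite length_seq at 1; apply Csum_Cmod_le; intros d Hd; apply in_seq in Hd.
assert (1 <= INR d) by (apply (le_INR 1); lia).
rewrite Cmod_mult, Cmod_R, Cmod_cpow by lra.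
replace (Re (INR b * z)) with (INR b * Re z) by (destruct z; simpl; ring).
pose proof (pos_INR b); pose proof (psi_bound (x / INR d ^ b)).
assert (Rpower (INR d) (INR b * Re z) <= 1) by (apply Rpower_le_1; nra).
assert (0 < Rpower (INR d) (INR b * Re z)) by apply exp_pos.
pose proof (Rabs_pos (psi (x / INR d ^ b))); nra.
Qed.

Lemma psi_sum_large_trivial z b x N : Re z <= 0 -> INR N <= x ->
  Cmod (psi_sum_large z b x N) <= INR N.
Proof.
intros Hz HN; unfold psi_sum_large.
rewrite <- (Rmult_1_l (INR N)), <- (length_seq N 1).
rewrite length_seq at 1; apply Csum_Cmod_le; intros m Hm; apply in_seq in Hm.
assert (1 <= INR m) by (apply (le_INR 1); lia).
assert (INR m <= INR N) by (apply le_INR; lia).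
assert (1 <= x / INR m).
{ apply Rmult_le_reg_r with (INR m); [lra|].
  replace (x / INR m * INR m) with x by (field; lra); lra. }
rewrite Cmod_mult, Cmod_R, Cmod_cpow by lra.
pose proof (psi_bound (root b (x / INR m))).
assert (Rpower (x / INR m) (Re z) <= 1) by (apply Rpower_le_1; lra).
assert (0 < Rpower (x / INR m) (Re z)) by apply exp_pos.
pose proof (Rabs_pos (psi (root b (x / INR m)))); nra.
Qed.

Lemma Rpower_third_pow x : 0 < x -> Rpower x (1 / 3) ^ 3 = x.
Proof.
intros Hx; rewrite <- Rpower_pow by apply exp_pos.
rewrite Rpower_mult; replace (1 / 3 * INR 3) with 1 by (simpl; field).
apply Rpower_1, Hx.
Qed.

Lemma Rpower_third_ge_1 x : 1 <= x -> 1 <= Rpower x (1 / 3).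
Proof.
intros Hx; rewrite <- (Rpower_O x) at 1 by lra; apply Rpower_le_exp; lra.
Qed.

(** The weights n^z have modulus at most 1 and change by at most 2 |z| / n, so [psi_sum_weighted]
    applies with A = 2 |z|. *)
Lemma psi_sum_small_bound (z : C) (x : R) (N : nat) :
  Re z <= 0 -> 1 <= x -> INR N ^ 2 <= x ->
  Cmod (psi_sum_small z 1 x N)
  <= 1500 * (1 + 2 * Cmod z) * Rpower x (1 / 3) * (1 + ln x) ^ 2.
Proof.
intros Hz Hx HN.
replace (psi_sum_small z 1 x N)
  with (Csum (fun n => (cpow (INR n) z * psi (x / INR n))%C) (seq 1 N)).
2:{ symmetry; apply Csum_ext; intros d _; rewrite pow_1; do 2 f_equal; simpl INR; ring. }
pose proof (Cmod_ge_0 z).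
apply psi_sum_weighted; trivial.
- apply Rpower_third_ge_1, Hx.
- apply Rpower_third_pow; lra.
- lra.
- intros n Hn; assert (1 <= INR n) by (apply (le_INR 1); lia).
  rewrite Cmod_cpow by lra; apply Rpower_le_1; assumption.
- intros n Hn; assert (1 <= INR n) by (apply (le_INR 1); lia).
  rewrite plus_INR; simpl (INR 1).
  eapply Rle_trans; [apply (cpow_increment z (/ INR n)); [lra|]|].
  + intros t Ht; replace (Re z - 1) with (-1 + Re z) by ring.
    rewrite <- Rinv_Rpower by lra.
    assert (Rpower t (Re z) <= 1) by (apply Rpower_le_1; lra).
    assert (/ t <= / INR n) by (apply Rinv_le_contravar; lra).
    assert (0 < / t) by (apply Rinv_0_lt_compat; lra).
    assert (0 < Rpower t (Re z)) by apply exp_pos.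
    nra.
  + right; field; lra.
Qed.

(** For beta = 1 the root is trivial and the sum again runs over psi (x / n), now with weights
    (x/n)^z, of modulus at most 1 because n <= x. *)
Lemma psi_sum_large_bound (z : C) (x : R) (N : nat) :
  Re z <= 0 -> 1 <= x -> INR N ^ 2 <= x ->
  Cmod (psi_sum_large z 1 x N)
  <= 1500 * (1 + 2 * Cmod z) * Rpower x (1 / 3) * (1 + ln x) ^ 2.
Proof.
intros Hz Hx HN.
assert (HNx : forall n, (1 <= n <= N)%nat -> 1 <= INR n <= x).
{ intros n Hn; assert (1 <= INR n) by (apply (le_INR 1); lia).
  assert (INR n <= INR N) by (apply le_INR; lia); nra. }
replace (psi_sum_large z 1 x N)
  with (Csum (fun n => ((cpow x z * cpow (INR n) (- z)) * psi (x / INR n))%C) (seq 1 N)).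
2:{ symmetry; apply Csum_ext; intros m Hm; apply in_seq in Hm; specialize (HNx m ltac:(lia)).
    rewrite cpow_div by lra; unfold root.
    replace (1 / INR 1) with 1 by (simpl; field).
    rewrite Rpower_1 by (apply Rdiv_lt_0_compat; lra); reflexivity. }
pose proof (Cmod_ge_0 z).
apply (psi_sum_weighted x _ _ (fun n => cpow x z * cpow (INR n) (- z))%C); trivial.
- apply Rpower_third_ge_1, Hx.
- apply Rpower_third_pow; lra.
- lra.
- intros n Hn; specialize (HNx n Hn).
  rewrite <- cpow_div, Cmod_cpow by (try apply Rdiv_lt_0_compat; lra).
  apply Rpower_le_1; [|exact Hz].
  apply Rmult_le_reg_r with (INR n); [lra|].
  replace (x / INR n * INR n) with x by (field; lra); lra.
- intros n Hn; pose proof (HNx n ltac:(lia)); pose proof (HNx (n + 1)%nat ltac:(lia)) as Hn1.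
  rewrite plus_INR in *; simpl (INR 1) in *.
  replace (cpow x z * cpow (INR n + 1) (- z) - cpow x z * cpow (INR n) (- z))%C
    with (cpow x z * (cpow (INR n + 1) (- z) - cpow (INR n) (- z)))%C by ring.
  assert (Rz : Re (- z) = - Re z) by (destruct z; reflexivity).
  rewrite Cmod_mult, Cmod_cpow by lra.
  (* The factor n^(-z) alone may grow, but on [n, n + 1] its derivative is at most |z| x^(-Re z) /
     n, and x^(Re z) in front cancels the growth. *)
  apply Rle_trans with (Rpower x (Re z) * (2 * (Cmod z * (Rpower x (- Re z) * / INR n) * (INR n + 1 - INR n)))).
  + apply Rmult_le_compat_l; [left; apply exp_pos|].
    rewrite <- (Cmod_opp z).
    apply cpow_increment; [lra|].
    intros t Ht; replace (Re (- z) - 1) with (-1 + - Re z) by (rewrite Rz; ring).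
    rewrite <- Rinv_Rpower, Rmult_comm by lra.
    apply Rmult_le_compat; [left; apply exp_pos | left; apply Rinv_0_lt_compat; lra | |].
    * apply Rle_Rpower_l; lra.
    * apply Rinv_le_contravar; lra.
  + right; rewrite Rpower_Ropp; field; split; [lra|].
    apply Rgt_not_eq, exp_pos.
Qed.

(** The shift to 1 + ln x keeps the scale at least 1 from x = 1 on; a bound on all of [1, oo) is
    needed because the half weight at x >= 2 refers back to x - 1. *)
Definition error_scale (x : R) : R := Rpower x (1 / 3) * (1 + ln x) ^ 2.

Lemma error_scale_ge x : 1 <= x -> Rpower x (1 / 3) <= error_scale x.
Proof.
intros Hx; unfold error_scale.
assert (0 <= ln x) by (rewrite <- ln_1; apply ln_le; lra).
pose proof (Rpower_third_ge_1 x Hx); nra.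
Qed.

Lemma full_sum_bound (z : C) (b : nat) :
  b = 1%nat \/ b = 2%nat -> Re z <= 0 -> -1 < INR b * Re z ->
  ~ (b = 1%nat /\ z = RtoC 0) ->
  exists K, 0 <= K /\ forall x, 1 <= x ->
  Cmod (Csum (divisor_sigma z b) (seq 1 (nat_floor x)) - main_term z b x)%C
  <= K * error_scale x.
Proof.
intros Hb Hz Hw Hne.
assert (Hb1 : (1 <= b)%nat) by lia.
(* Both zeta arguments hit the pole 1 simultaneously, and here only for b = 1, z = 0; for b = 2 the
   real part excludes it. *)
assert (H2 : (1 - INR b * (1 - z))%C <> RtoC 0).
{ intros E; apply Hne; pose proof (f_equal Re E) as E1; pose proof (f_equal Im E) as E2.
  destruct z as [u v]; simpl in *.
  destruct Hb as [-> | ->]; simpl in *; [|lra].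
  split; [reflexivity|]; apply C_eq; simpl; lra. }
destruct (hyperbola_bound z b Hb1 Hw Hz H2) as [K HK].
exists (Rabs K + 2 + 2 * (1500 * (1 + 2 * Cmod z))).
pose proof (Rabs_pos K); pose proof (Cmod_ge_0 z); split; [lra|].
intros x Hx; pose proof (error_scale_ge x Hx) as Sx.
pose proof (Rpower_third_ge_1 x Hx) as Tx.
assert (Ey : x = root (S b) x ^ S b) by (symmetry; apply root_pow; [lia | lra]).
assert (Hy : 1 <= root (S b) x).
{ apply (pow_le_inv _ _ (S b)); [left; apply exp_pos | lia |].
  rewrite pow1, <- Ey; exact Hx. }
specialize (HK x (root (S b) x) Hy Ey).
pose proof (nat_floor_bounds (root (S b) x) ltac:(lra)) as F.
set (y := root (S b) x) in *; set (N := nat_floor y) in *.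
eapply Rle_trans; [exact HK|].
pose proof (Rle_abs K).
assert (D : Cmod (psi_sum_small z b x N) + Cmod (psi_sum_large z b x N)
  <= (2 + 2 * (1500 * (1 + 2 * Cmod z))) * error_scale x).
{ destruct Hb as [-> | ->].
  - assert (HN : INR N ^ 2 <= x) by (rewrite Ey; apply pow_incr; split; [apply pos_INR | lra]).
    pose proof (psi_sum_small_bound z x N Hz Hx HN).
    pose proof (psi_sum_large_bound z x N Hz Hx HN).
    unfold error_scale in *; nra.
  - assert (Y : y = Rpower x (1 / 3)).
    { unfold y, root; do 2 f_equal; simpl; ring. }
    pose proof (psi_sum_small_trivial z 2 x N Hz).
    assert (y <= x) by (rewrite Ey at 1; simpl; nra).
    pose proof (psi_sum_large_trivial z 2 x N Hz ltac:(lra)).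
    nra. }
nra.
Qed.

(** * The case beta >= 3 *)

Lemma inv_cube_sum N M : (1 <= N)%nat ->
  Rsum (fun n => / INR n ^ 3) (seq (1 + N) M) <= / (INR N * (INR N + 1)).
Proof.
intros HN; assert (HN1 : 1 <= INR N) by (apply (le_INR 1); lia).
assert (H : Rsum (fun n => / INR n ^ 3) (seq (1 + N) M)
  <= / (INR N * (INR N + 1)) - / (INR (N + M) * (INR (N + M) + 1))).
{ induction M as [|M IH]; [simpl; rewrite Nat.add_0_r; lra|].
  rewrite Rsum_seq_S.
  replace (1 + N + M)%nat with (S (N + M)) by lia.
  replace (N + S M)%nat with (S (N + M)) by lia.
  rewrite S_INR; set (t := INR (N + M)) in *.
  assert (Ht : 1 <= t) by (unfold t; rewrite plus_INR; pose proof (pos_INR M); lra).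
  assert (/ (t + 1) ^ 3 <= / (t * (t + 1)) - / ((t + 1) * (t + 1 + 1))).
  { replace (/ (t * (t + 1)) - / ((t + 1) * (t + 1 + 1)))
      with (/ (t * (t + 1) * (t + 2) / 2)) by (field; lra).
    apply Rinv_le_contravar; nra. }
  lra. }
assert (0 < / (INR (N + M) * (INR (N + M) + 1))).
{ pose proof (le_INR N (N + M) ltac:(lia)); apply Rinv_0_lt_compat; nra. }
lra.
Qed.

Lemma zeta_tail (s : C) (N : nat) : 3 <= Re s -> (1 <= N)%nat ->
  Cmod (zeta s - Csum (fun k => cpow (INR k) (- s)) (seq 1 N))%C
  <= / (INR N * (INR N + 1)).
Proof.
intros Hs HN; pose proof (zeta_Dirichlet_series s ltac:(lra)) as L.
set (c := Csum _ _).
apply le_epsilon; intros eps Heps.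
destruct (proj1 (filterlim_locally_ball_norm (K := C_AbsRing) (U := C_NormedModule) _ _) L
  (mkposreal _ Heps)) as [M HM].
specialize (HM (N + M)%nat ltac:(lia)).
change (Cmod (sum_n (G := C_AbelianMonoid) (fun n => cpow (INR (S n)) (- s)) (N + M) - zeta s)%C < eps) in HM.
unfold sum_n in HM.
rewrite (sum_n_m_S (G := C_AbelianMonoid) (fun k => cpow (INR k) (- s)) 0 (N + M)), Csum_seq in HM.
replace (S (N + M)) with (N + S M)%nat in HM by lia.
rewrite seq_app, Csum_app in HM; fold c in HM.
assert (B : Cmod (Csum (fun k => cpow (INR k) (- s)) (seq (1 + N) (S M)))
  <= / (INR N * (INR N + 1))).
{ eapply Rle_trans; [apply Csum_Cmod|].
  eapply Rle_trans; [|apply (inv_cube_sum N (S M) HN)].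
  apply Rsum_le; intros n Hn; apply in_seq in Hn.
  assert (1 <= INR n) by (apply (le_INR 1); lia).
  rewrite Cmod_cpow, <- Rpower_pow, <- Rpower_Ropp by lra.
  apply Rpower_le_exp; [lra|].
  replace (Re (- s)) with (- Re s) by (destruct s; reflexivity).
  replace (INR 3) with 3 by (simpl; ring); lra. }
set (t := Csum _ (seq (1 + N) (S M))) in *.
replace (zeta s - c)%C with (t + - (c + t - zeta s))%C by ring.
eapply Rle_trans; [apply Cmod_triangle|]; rewrite Cmod_opp; lra.
Qed.

(** An absolute bound: it keeps the increment of the main term over a unit step independent of
    beta. *)
Lemma zeta_bound (s : C) : 3 <= Re s -> Cmod (zeta s) <= 2.
Proof.
intros Hs; pose proof (zeta_tail s 1 Hs (le_n 1)) as H.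
simpl Csum in H; simpl INR in H; rewrite cpow_1_l in H.
replace (zeta s) with (zeta s - (1 + 0) + 1)%C by ring.
eapply Rle_trans; [apply Cmod_triangle|]; rewrite Cmod_1.
assert (/ (1 * (1 + 1)) <= 1) by lra; lra.
Qed.

Lemma Re_scaled (b : nat) (z : C) : (3 <= b)%nat -> Re z <= 0 -> 3 <= Re (INR b * (1 - z)).
Proof.
intros Hb Hz; replace (Re (INR b * (1 - z))) with (INR b - INR b * Re z) by (destruct z; simpl; ring).
assert (3 <= INR b) by (replace 3 with (INR 3) by (simpl; ring); apply le_INR, Hb).
nra.
Qed.

(** For d > T = x^(1/3) already d^b >= d^3 > x, so the quotient vanishes. The constant 4 collects T
    from the psi sum, T from the halves, and 2 T from the tail of zeta. *)
Lemma full_sum_bound_ge3 (z : C) (b : nat) (x : R) :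
  (3 <= b)%nat -> Re z <= 0 -> 1 <= x ->
  Cmod (Csum (divisor_sigma z b) (seq 1 (nat_floor x)) - zeta (INR b * (1 - z)) * x)%C
  <= 4 * error_scale x.
Proof.
intros Hb Hz Hx.
apply Rle_trans with (4 * Rpower x (1 / 3)); [|pose proof (error_scale_ge x Hx); lra].
pose proof (Rpower_third_pow x ltac:(lra)) as HT3.
pose proof (Rpower_third_ge_1 x Hx) as HT.
set (T := Rpower x (1 / 3)) in *.
assert (HTx : T <= x) by (rewrite <- HT3; simpl; nra).
pose proof (nat_floor_bounds T ltac:(lra)) as FT.
pose proof (nat_floor_bounds x ltac:(lra)) as Fx.
assert (HN : (1 <= nat_floor T)%nat) by (apply nat_floor_ge; simpl; lra).
assert (HNX : (nat_floor T <= nat_floor x)%nat) by (apply nat_floor_ge; lra).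
set (N := nat_floor T) in *.
set (s := (INR b * (1 - z))%C).
rewrite divisor_sum by lia.
assert (E : Csum (fun d => (cpow (INR d) (INR b * z) * INR (nat_floor x / d ^ b))%C) (seq 1 (nat_floor x))
  = (x * Csum (fun d => cpow (INR d) (- s)) (seq 1 N) - psi_sum_small z b x N
     - / 2 * Csum (fun d => cpow (INR d) (INR b * z)) (seq 1 N))%C).
{ replace (seq 1 (nat_floor x)) with (seq 1 N ++ seq (1 + N) (nat_floor x - N))
    by (rewrite <- seq_app; f_equal; lia).
  rewrite Csum_app, (Csum_ext _ (fun _ => RtoC 0) (seq (1 + N) _)).
  - rewrite Csum_const; unfold psi_sum_small.
    rewrite <- !Csum_scal, <- !Csum_minus, Cmult_0_r, Cplus_0_r.
    apply Csum_ext; intros d Hd; apply in_seq in Hd.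
    rewrite floor_div_term by (lia || lra).
    replace (- (INR b - INR b * z))%C with (- s)%C by (unfold s; ring); reflexivity.
  - intros d Hd; apply in_seq in Hd.
    rewrite Nat.div_small; [simpl (INR 0); ring|].
    assert (Hd1 : INR N + 1 <= INR d) by (rewrite <- S_INR; apply le_INR; lia).
    apply nat_floor_lt; [lra|]; rewrite pow_INR.
    apply Rlt_le_trans with (INR d ^ 3); [rewrite <- HT3; apply pow_lt_compat; [lra|lia]|].
    apply Rle_pow; [lra|lia]. }
rewrite E.
pose proof (zeta_tail s N (Re_scaled b z Hb Hz) HN) as Z.
pose proof (psi_sum_small_trivial z b x N Hz) as P.
assert (Q : Cmod (/ 2 * Csum (fun d => cpow (INR d) (INR b * z)) (seq 1 N)) <= INR N).
{ rewrite Cmod_mult, <- RtoC_inv, Cmod_R, Rabs_pos_eq by lra.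
  assert (Cmod (Csum (fun d => cpow (INR d) (INR b * z)) (seq 1 N)) <= 1 * INR (length (seq 1 N))).
  { apply Csum_Cmod_le; intros d Hd; apply in_seq in Hd.
    assert (1 <= INR d) by (apply (le_INR 1); lia).
    rewrite Cmod_cpow by lra; apply Rpower_le_1; [lra|].
    replace (Re (INR b * z)) with (INR b * Re z) by (destruct z; simpl; ring).
    pose proof (pos_INR b); nra. }
  rewrite length_seq in *; pose proof (pos_INR N); lra. }
set (c := Csum (fun d => cpow (INR d) (- s)) (seq 1 N)) in *.
set (q := (/ 2 * _)%C) in *.
replace (x * c - psi_sum_small z b x N - q - zeta s * x)%C
  with (- (x * (zeta s - c)) + - (psi_sum_small z b x N + q))%C by ring.
eapply Rle_trans; [apply Cmod_triangle|].
rewrite !Cmod_opp, Cmod_mult, Cmod_R, Rabs_pos_eq by lra.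
pose proof (Cmod_triangle (psi_sum_small z b x N) q).
assert (HN1 : 1 <= INR N) by (apply (le_INR 1); exact HN).
(* T < N + 1 <= 2 N gives T^2 <= 2 N (N + 1), hence x / (N (N + 1)) <= 2 T. *)
assert (x * Cmod (zeta s - c) <= 2 * T).
{ apply Rle_trans with (x * / (INR N * (INR N + 1))).
  - apply Rmult_le_compat_l; lra.
  - apply Rmult_le_reg_r with (INR N * (INR N + 1)); [nra|].
    rewrite Rmult_assoc, Rinv_l, Rmult_1_r by nra.
    rewrite <- HT3; replace (T ^ 3) with (T * T ^ 2) by ring.
    rewrite (Rmult_comm 2), Rmult_assoc; apply Rmult_le_compat_l; [lra|]; nra. }
lra.
Qed.

(** * The half weight at integers and the final assembly *)

Lemma half_sum_error (f : nat -> C) (D : R -> C) (K : R) :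
  0 <= K ->
  (forall x, 1 <= x -> Cmod (Csum f (seq 1 (nat_floor x)) - D x)%C <= K * error_scale x) ->
  (forall x, 2 <= x -> Cmod (D x - D (x - 1)%R)%C <= K) ->
  forall x, 2 <= x ->
  Cmod (half_sum f x - D x)%C <= 27 * K * (Rpower x (1 / 3) * ln x ^ 2).
Proof.
intros K0 HF HD x Hx.
assert (Hl2 : 1 <= 2 * ln 2) by (pose proof ln_lt_2; lra).
assert (Hlx : ln 2 <= ln x) by (apply ln_le; lra).
pose proof (Rpower_third_ge_1 x ltac:(lra)) as T1.
pose proof (error_scale_ge x ltac:(lra)) as S1.
(* At an integer the error at x counts once, and half of the sum of the errors at x and x - 1 and
   the increment of D is added: 5/2 in units of [K * error_scale x], rounded to 3. *)
apply Rle_trans with (3 * K * error_scale x).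
- unfold half_sum; rewrite Csum_seq.
  pose proof (HF x ltac:(lra)) as F1.
  pose proof (Rmult_le_compat_l K _ _ K0 (Rle_trans _ _ _ T1 S1)) as F0.
  destruct (Req_dec_T x (INR (nat_floor x))) as [E|E].
  + set (n := nat_floor x) in *.
    assert (Hn : (2 <= n)%nat) by (apply nat_floor_ge; simpl; lra).
    assert (E1 : nat_floor (x - 1) = (n - 1)%nat).
    { rewrite E; replace (INR n - 1) with (INR (n - 1)); [apply nat_floor_INR|].
      rewrite minus_INR by lia; reflexivity. }
    assert (E2 : f n = (Csum f (seq 1 n) - Csum f (seq 1 (n - 1)))%C).
    { replace n with (S (n - 1)) at 2 by lia; rewrite Csum_seq_S.
      replace (1 + (n - 1))%nat with n by lia; ring. }
    pose proof (HF (x - 1) ltac:(lra)) as F2; rewrite E1 in F2.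
    specialize (HD x Hx).
    assert (S2 : error_scale (x - 1) <= error_scale x).
    { unfold error_scale; apply Rmult_le_compat; [left; apply exp_pos | apply pow2_ge_0 | |].
      - apply Rle_Rpower_l; lra.
      - assert (0 <= ln (x - 1)) by (rewrite <- ln_1; apply ln_le; lra).
        assert (ln (x - 1) <= ln x) by (apply ln_le; lra).
        apply pow_incr; lra. }
    pose proof (Rmult_le_compat_l K _ _ K0 S2).
    rewrite E2.
    set (u := Csum f (seq 1 n)) in *; set (v := Csum f (seq 1 (n - 1))) in *.
    replace (u - / 2 * (u - v) - D x)%C
      with ((u - D x) + - (/ 2 * ((u - D x) + (- (v - D (x - 1)%R) + (D x - D (x - 1)%R)))))%C by ring.
    eapply Rle_trans; [apply Cmod_triangle|].
    rewrite Cmod_opp, Cmod_mult, <- RtoC_inv, Cmod_R, Rabs_pos_eq by lra.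
    pose proof (Cmod_triangle (u - D x) (- (v - D (x - 1)%R) + (D x - D (x - 1)%R))) as Q1.
    pose proof (Cmod_triangle (- (v - D (x - 1)%R)) (D x - D (x - 1)%R)) as Q2.
    rewrite Cmod_opp in Q2; lra.
  + replace (Csum f (seq 1 (nat_floor x)) - 0 - D x)%C
      with (Csum f (seq 1 (nat_floor x)) - D x)%C by ring; lra.
- unfold error_scale.
  (* For x >= 2, 1 <= 2 ln 2 <= 2 ln x, so 1 + ln x <= 3 ln x; hence 27 = 3 . 9. *)
  assert ((1 + ln x) ^ 2 <= 9 * ln x ^ 2).
  { replace (9 * ln x ^ 2) with ((3 * ln x) ^ 2) by ring; apply pow_incr; lra. }
  replace (27 * K * (Rpower x (1 / 3) * ln x ^ 2))
    with (3 * K * (Rpower x (1 / 3) * (9 * ln x ^ 2))) by ring.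
  apply Rmult_le_compat_l; [lra|]; apply Rmult_le_compat_l; lra.
Qed.

(** The exponent s = z + 1/b has real part at most 1, so x^s has derivative bounded by |s| on [1,
    oo). *)
Lemma main_term_increment (z : C) (b : nat) : (1 <= b)%nat -> Re z <= 0 ->
  exists K, 0 <= K /\ forall x, 2 <= x ->
  Cmod (main_term z b x - main_term z b (x - 1)%R)%C <= K.
Proof.
intros Hb Hz; unfold main_term.
set (s := (z + 1 / INR b)%C); set (c := (1 / (1 + INR b * z) * zeta s)%C).
exists (Cmod (zeta (INR b * (1 - z))) + Cmod c * (2 * Cmod s)).
pose proof (Cmod_ge_0 (zeta (INR b * (1 - z)))); pose proof (Cmod_ge_0 c); pose proof (Cmod_ge_0 s).
split; [apply Rplus_le_le_0_compat; [lra|]; apply Rmult_le_pos; lra|].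
intros x Hx; rewrite RtoC_minus.
match goal with |- Cmod ?u <= _ => replace u with
  (zeta (INR b * (1 - z)) + c * (cpow x s - cpow (x - 1) s))%C by ring end.
eapply Rle_trans; [apply Cmod_triangle|]; rewrite Cmod_mult.
apply Rplus_le_compat_l, Rmult_le_compat_l; [lra|].
replace (2 * Cmod s) with (2 * (Cmod s * 1 * (x - (x - 1)))) by ring.
apply cpow_increment; [lra|]; intros t Ht; apply Rpower_le_1; [lra|].
assert (1 <= INR b) by (apply (le_INR 1); exact Hb).
unfold s; rewrite re_plus, <- RtoC_div by lra; simpl.
assert (1 / INR b <= 1).
{ apply Rmult_le_reg_r with (INR b); [lra|]; unfold Rdiv.
  rewrite Rmult_assoc, Rinv_l; lra. }
lra.
Qed.

Lemma half_sum_bound (z : C) (b : nat) :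
  b = 1%nat \/ b = 2%nat -> Re z <= 0 -> - (2 / (3 * INR b ^ 2)) < Re z ->
  ~ (b = 1%nat /\ z = RtoC 0) ->
  exists K, forall x, 2 <= x ->
  Cmod (half_sum (divisor_sigma z b) x - main_term z b x)%C
  <= K * (Rpower x (1 / 3) * ln x ^ 2).
Proof.
intros Hb Hz Hz' Hne.
(* The admissible range reads b Re z > -2/3 for b = 1 and b Re z > -1/3 for b = 2. *)
assert (Hw : -1 < INR b * Re z) by (destruct Hb as [-> | ->]; simpl in *; lra).
destruct (full_sum_bound z b Hb Hz Hw Hne) as [K1 [K1p HK1]].
destruct (main_term_increment z b ltac:(lia) Hz) as [K2 [K2p HK2]].
exists (27 * (K1 + K2)); apply half_sum_error; [lra| |].
- intros x Hx; eapply Rle_trans; [apply HK1, Hx|].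
  pose proof (error_scale_ge x Hx); pose proof (Rpower_third_ge_1 x Hx).
  apply Rmult_le_compat_r; lra.
- intros x Hx; specialize (HK2 x Hx); lra.
Qed.

Lemma half_sum_bound_ge3 (z : C) (b : nat) (x : R) :
  (3 <= b)%nat -> Re z <= 0 -> 2 <= x ->
  Cmod (half_sum (divisor_sigma z b) x - zeta (INR b * (1 - z)) * x)%C
  <= 27 * 4 * (Rpower x (1 / 3) * ln x ^ 2).
Proof.
intros Hb Hz.
apply (half_sum_error _ (fun x => zeta (INR b * (1 - z)) * x)%C); [lra| |].
- intros t Ht; apply full_sum_bound_ge3; assumption.
- intros t Ht; rewrite RtoC_minus.
  match goal with |- Cmod ?u <= _ => replace u with (zeta (INR b * (1 - z))) by ring end.
  pose proof (zeta_bound _ (Re_scaled b z Hb Hz)); lra.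
Qed.

(** The bound on the error term is claimed for every beta, the identity only in its range [P].
    Outside [P] the error term is set to 0, by a classical case distinction, so that the bound
    survives. *)
Lemma error_term_exists (P : Prop) (f m : R -> C) (g : R -> R) :
  (P -> exists K, forall x, 2 <= x -> Cmod (f x - m x)%C <= K * g x) ->
  exists (e : R -> C) (K : R),
    (forall x, 2 <= x -> Cmod (e x) <= K * g x)
    /\ (P -> forall x, f x = (m x + e x)%C).
Proof.
intros H; destruct (Classical_Prop.classic P) as [p|p].
- destruct (H p) as [K HK]; exists (fun x => f x - m x)%C, K; split; [exact HK|].
  intros _ x; ring.
- exists (fun _ => RtoC 0), 0; split; [|contradiction].
  intros x _; rewrite Cmod_0; lra.
Qed.

Theorem theorem1p4 (z : C) (hz : Re z <= 0) :
  exists Delta : nat -> R -> C,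
    (exists K : R, forall (beta : nat) (x : R), (1 <= beta)%nat -> 2 <= x ->
       Cmod (Delta beta x) <= K * (Rpower x (1 / 3) * ln x ^ 2))
    /\ (forall (beta : nat) (x : R),
          beta = 1%nat \/ beta = 2%nat ->
          - (2 / (3 * INR beta ^ 2)) < Re z ->
          ~ (beta = 1%nat /\ z = RtoC 0) ->
          0 < x ->
          half_sum (divisor_sigma z beta) x
          = (zeta (INR beta * (1 - z)) * x
             + 1 / (1 + INR beta * z) * zeta (z + 1 / INR beta)
               * cpow x (z + 1 / INR beta)
             + Delta beta x)%C)
    /\ (forall (beta : nat) (x : R),
          (3 <= beta)%nat ->
          -1 < Re z ->
          0 < x ->
          half_sum (divisor_sigma z beta) x
          = (zeta (INR beta * (1 - z)) * x + Delta beta x)%C).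
Proof.
set (g := fun x => Rpower x (1 / 3) * ln x ^ 2).
assert (Hex : forall b, b = 1%nat \/ b = 2%nat -> exists (e : R -> C) (K : R),
  (forall x, 2 <= x -> Cmod (e x) <= K * g x)
  /\ (- (2 / (3 * INR b ^ 2)) < Re z /\ ~ (b = 1%nat /\ z = RtoC 0) ->
      forall x, half_sum (divisor_sigma z b) x = (main_term z b x + e x)%C)).
{ intros b Hb; apply error_term_exists; intros [H1 H2]; apply half_sum_bound; assumption. }
destruct (Hex 1%nat (or_introl eq_refl)) as [e1 [K1 [B1 E1]]].
destruct (Hex 2%nat (or_intror eq_refl)) as [e2 [K2 [B2 E2]]].
set (e3 := fun b x => (half_sum (divisor_sigma z b) x - zeta (INR b * (1 - z)) * x)%C).
exists (fun b => match b with 1%nat => e1 | 2%nat => e2 | _ => e3 b end).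
split; [|split].
(* The constants for beta = 1 and beta = 2 depend on z; all beta >= 3 share 27 . 4. Their sum
   dominates each, uniformly in beta. *)
- exists (Rabs K1 + Rabs K2 + 27 * 4); intros b x Hb Hx; fold (g x).
  assert (Hg : 0 <= g x).
  { unfold g; apply Rmult_le_pos; [left; apply exp_pos | apply pow2_ge_0]. }
  assert (Hle : forall K, K <= Rabs K1 + Rabs K2 + 27 * 4 ->
    K * g x <= (Rabs K1 + Rabs K2 + 27 * 4) * g x)
    by (intros K HK; apply Rmult_le_compat_r; assumption).
  pose proof (Rle_abs K1); pose proof (Rle_abs K2).
  pose proof (Rabs_pos K1); pose proof (Rabs_pos K2).
  destruct b as [|[|[|b]]]; [lia | | |].
  + eapply Rle_trans; [apply B1, Hx | apply Hle; lra].
  + eapply Rle_trans; [apply B2, Hx | apply Hle; lra].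
  + eapply Rle_trans; [apply half_sum_bound_ge3; [lia | exact hz | exact Hx] | apply Hle; lra].
- intros b x [-> | ->] H1 H2 _; [apply E1 | apply E2]; split; assumption.
- intros [|[|[|b]]] x Hb _ _; try lia; unfold e3; ring.
Qed.
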